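(* Let $A,B\in\mathbb{C}^{d\times d}$. Then for every $r\in\{1,\dots,d\}$, $$\sigma\!\left(\bigwedge\nolimits^{r}A+\bigwedge\nolimits^{r}B\right)\prec_w\left(\prod_{t=1}^r\sigma_{i_t}(A)+\prod_{t=1}^r\sigma_{i_t}(B)\right)^{\downarrow}_{1\le i_1<\cdots<i_r\le d},$$ and for every integer $r\ge1$, $$\sigma\big(\mathrm{Sym}^rA+\mathrm{Sym}^rB\big)\prec_w\left(\prod_{t=1}^r\sigma_{i_t}(A)+\prod_{t=1}^r\sigma_{i_t}(B)\right)^{\downarrow}_{1\le i_1\le\cdots\le i_r\le d}.$$ If $A,B\ge0$ (positive semidefinite), then in both statements $\sigma$ can be replaced by $\lambda$ and $\prec_w$ by $\prec$.
   Context: $\bigwedge^rA$ and $\mathrm{Sym}^rA$ are the $r$-th exterior and symmetric powers of $A$, i.e. the operators induced by $A^{\otimes r}$ on the antisymmetric, respectively symmetric, subspace of $(\mathbb{C}^d)^{\otimes r}$ with the inherited inner product (represented in orthonormal bases: the wedge basis, respectively the basis of normalized symmetrized tensors, of the standard basis). $\sigma(X)$, with entries $\sigma_1(X)\ge\sigma_2(X)\ge\cdots$, is the vector of singular values in decreasing order, and $\lambda(X)$ is the vector of eigenvalues of a Hermitian $X$ in decreasing order (both with multiplicity). The right-hand sides are vectors whose entries are indexed by the tuples $(i_1,\dots,i_r)$ indicated, and $\downarrow$ denotes decreasing rearrangement. For $x,y\in\mathbb{R}^N$, weak majorization $x\prec_w y$ means $\sum_{i=1}^k x_i^\downarrow\le\sum_{i=1}^k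 y_i^\downarrow$ for all $k\in\{1,\dots,N\}$; majorization $x\prec y$ requires in addition equality for $k=N$. *)

(* Defs.v *)
From HB Require Import structures.
From mathcomp Require Import all_boot all_order all_algebra all_fingroup.
From mathcomp Require Import spectral sesquilinear.
From mathcomp Require Import complex reals.

Set Implicit Arguments.
Unset Strict Implicit.
Unset Printing Implicit Defensive.

Import Order.TTheory GRing.Theory Num.Theory.
Local Open Scope ring_scope.
Local Open Scope sesquilinear_scope.

Definition decr (R : realType) (N : nat) (x : 'rV[R]_N) : 'rV[R]_N :=
  \row_(i < N) (sort >=%R [seq x 0 j | j <- enum 'I_N])`_i.

Definition weak_maj (R : realType) (N : nat) (x y : 'rV[R]_N) : Prop :=
  forall k : nat, (1 <= k <= N)%N ->
    \sum_(i < N | (i < k)%N) decr x 0 i <= \sum_(i < N | (i < k)%N) decr y 0 i.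

Definition maj (R : realType) (N : nat) (x y : 'rV[R]_N) : Prop :=
  weak_maj x y /\ \sum_(i < N) decr x 0 i = \sum_(i < N) decr y 0 i.

(* The roots of the characteristic polynomial, with algebraic multiplicity,
   in no particular order. *)
Definition eigvals (R : realType) (n : nat) (X : 'M[R[i]]_n) : seq R[i] :=
  sval (closed_field_poly_normal (char_poly X)).

(* For Hermitian [X] the roots are real, so taking [complex.Re] only changes
   their type; for other [X] the value is not meaningful. *)
Definition lambda_vec (R : realType) (n : nat) (X : 'M[R[i]]_n) : 'rV[R]_n :=
  decr (\row_(i < n) complex.Re (eigvals X)`_i).

Definition sigma_vec (R : realType) (n : nat) (X : 'M[R[i]]_n) : 'rV[R]_n :=
  decr (\row_(i < n) Num.sqrt (complex.Re (eigvals (X ^t* *m X))`_i)).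

(* In the order of [R[i]], [0 <= z] says that [z] is real and nonnegative. *)
Definition psd (R : realType) (n : nat) (X : 'M[R[i]]_n) : Prop :=
  X \is hermsymmx /\
  forall v : 'cV[R[i]]_n, 0 <= (v ^t* *m X *m v) 0 0.

(* Index tuples (i_1, ..., i_r); the standard basis of the r-fold tensor power
   of C^d is indexed by them, through [enum_rank] and [enum_val]. *)
Notation multi d r := {ffun 'I_r -> 'I_d}.

Definition incr_tuples (d r : nat) : {set multi d r} :=
  [set g : multi d r | [forall s : 'I_r, forall t : 'I_r, (s < t)%N ==> (g s < g t)%N]].

Definition nondecr_tuples (d r : nat) : {set multi d r} :=
  [set g : multi d r | [forall s : 'I_r, forall t : 'I_r, (s < t)%N ==> (g s <= g t)%N]].

Definition tensor_pow (R : realType) (d r : nat) (A : 'M[R[i]]_d) :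
    'M[R[i]]_#|multi d r| :=
  \matrix_(i, j) \prod_(t < r)
    A ((enum_val i : multi d r) t) ((enum_val j : multi d r) t).

Definition tensor_elt (R : realType) (d r : nat) (f : multi d r) :
    'cV[R[i]]_#|multi d r| := delta_mx (enum_rank f) 0.

Definition hnorm (R : realType) (n : nat) (v : 'cV[R[i]]_n) : R[i] :=
  sqrtC ((v ^t* *m v) 0 0).

(* e_(g 1) /\ ... /\ e_(g r) *)
Definition wedge_elt (R : realType) (d r : nat) (g : multi d r) :
    'cV[R[i]]_#|multi d r| :=
  (sqrtC (r`!)%:R)^-1 *:
    \sum_(s : 'S_r) (-1) ^+ s *: tensor_elt R [ffun t => g (s t)].

Definition symmetrized (R : realType) (d r : nat) (g : multi d r) :
    'cV[R[i]]_#|multi d r| :=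
  (r`!%:R)^-1 *: \sum_(s : 'S_r) tensor_elt R [ffun t => g (s t)].

Definition sym_elt (R : realType) (d r : nat) (g : multi d r) :
    'cV[R[i]]_#|multi d r| :=
  (hnorm (symmetrized R g))^-1 *: symmetrized R g.

Definition wedge_basis (R : realType) (d r : nat) :
    'M[R[i]]_(#|multi d r|, #|incr_tuples d r|) :=
  \matrix_(i, j) wedge_elt R (enum_val j) i 0.

Definition sym_basis (R : realType) (d r : nat) :
    'M[R[i]]_(#|multi d r|, #|nondecr_tuples d r|) :=
  \matrix_(i, j) sym_elt R (enum_val j) i 0.

(* If the columns of [W] form an orthonormal basis of a [T]-invariant subspace,
   [W ^t* *m T *m W] is the matrix of the restriction of [T] to that subspace
   in that basis; the hypotheses are checked below ([wedge_basis_orthonormal],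
   [ext_powP], [sym_basis_orthonormal], [sym_powP]). *)
Definition ext_pow (R : realType) (d r : nat) (A : 'M[R[i]]_d) :
    'M[R[i]]_#|incr_tuples d r| :=
  (wedge_basis R d r) ^t* *m tensor_pow r A *m wedge_basis R d r.

Definition sym_pow (R : realType) (d r : nat) (A : 'M[R[i]]_d) :
    'M[R[i]]_#|nondecr_tuples d r| :=
  (sym_basis R d r) ^t* *m tensor_pow r A *m sym_basis R d r.

(* [x] is the vector of the x_i; the entries of the result are indexed by the
   tuples in [S]. *)
Definition prod_sums (R : realType) (d r : nat) (S : {set multi d r})
    (x y : 'rV[R]_d) : 'rV[R]_#|S| :=
  \row_(j < #|S|) (\prod_(t < r) x 0 (enum_val j t)
                   + \prod_(t < r) y 0 (enum_val j t)).

Lemma size_eigvals (R : realType) (n : nat) (X : 'M[R[i]]_n) :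
  size (eigvals X) = n.
Proof.
rewrite /eigvals; case: closed_field_poly_normal => s /= Xs.
have := size_char_poly X; rewrite Xs size_scale ?size_prod_XsubC; first by case.
by rewrite (monicP (char_poly_monic X)) oner_eq0.
Qed.

Lemma incr_nondecr (d r : nat) (g : multi d r) :
  (g \in incr_tuples d r) = (g \in nondecr_tuples d r) && injectiveb g.
Proof.
rewrite !inE; apply/idP/andP => [/'forall_forallP h|[/'forall_forallP h]].
  split.
    by apply/'forall_forallP => s t; apply/implyP => /(implyP (h s t))/ltnW.
  apply/injectiveP => s t gst; apply: val_inj.
  case: (ltngtP s t) => // st; have := implyP (h _ _) st;
    by rewrite gst ltnn.
move=> /injectiveP gI; apply/'forall_forallP => s t; apply/implyP => st.
rewrite ltn_neqAle (implyP (h s t) st) andbT.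
by apply: contraTneq st => /val_inj/gI ->; rewrite ltnn.
Qed.

Definition multi_perm (d r : nat) (g : multi d r) (s : 'S_r) : multi d r :=
  [ffun t => g (s t)].

Lemma multi_permM (d r : nat) (g : multi d r) (s t : 'S_r) :
  multi_perm (multi_perm g s) t = multi_perm g (t * s)%g.
Proof. by apply/ffunP => i; rewrite !ffunE permM. Qed.

Lemma multi_perm1 (d r : nat) (g : multi d r) : multi_perm g 1%g = g.
Proof. by apply/ffunP => i; rewrite !ffunE perm1. Qed.

Definition multi_seq (d r : nat) (g : multi d r) : seq nat :=
  [seq val (g t) | t <- enum 'I_r].

Lemma multi_seq_inj (d r : nat) : injective (@multi_seq d r).
Proof.
move=> g h /eq_in_map gh; apply/ffunP => t.
by apply/val_inj/gh; rewrite mem_enum.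
Qed.

Lemma nondecr_sorted (d r : nat) (g : multi d r) :
  (g \in nondecr_tuples d r) = sorted leq (multi_seq g).
Proof.
rewrite inE (sorted_pairwise leq_trans) /multi_seq pairwise_map.
apply/idP/idP => [/'forall_forallP h|h].
  have: pairwise ltn (map val (enum 'I_r)).
    by rewrite val_enum_ord -(sorted_pairwise ltn_trans) iota_ltn_sorted.
  rewrite pairwise_map; apply: sub_pairwise => s t st; exact: (implyP (h s t)).
apply/'forall_forallP => s t; apply/implyP => st.
have /(pairwiseP s) := h.
move=> /(_ s t); rewrite !inE -!cardE !card_ord !ltn_ord => /(_ isT isT st).
by rewrite !nth_ord_enum.
Qed.

Lemma multi_seq_perm (d r : nat) (g : multi d r) (s : 'S_r) :
  perm_eq (multi_seq (multi_perm g s)) (multi_seq g).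
Proof.
rewrite /multi_seq.
have -> : [seq val (multi_perm g s t) | t <- enum 'I_r] =
          [seq val (g t) | t <- [seq s t | t <- enum 'I_r]].
  by rewrite -[RHS]map_comp; apply: eq_map => t; rewrite /= ffunE.
apply: perm_map; apply: uniq_perm.
- by rewrite map_inj_uniq ?enum_uniq //; exact: perm_inj.
- exact: enum_uniq.
move=> t; rewrite mem_enum; apply/mapP; exists (s^-1 t)%g; last by rewrite permKV.
by rewrite mem_enum.
Qed.

Lemma nondecr_unique (d r : nat) (g h : multi d r) (s : 'S_r) :
  g \in nondecr_tuples d r -> h \in nondecr_tuples d r ->
  multi_perm g s = h -> g = h.
Proof.
rewrite !nondecr_sorted => gs hs gh; apply: multi_seq_inj.
apply: (sorted_eq leq_trans anti_leq) => //.
by rewrite -gh perm_sym multi_seq_perm.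
Qed.

Lemma nondecr_exists (d r : nat) (f : multi d r) :
  exists s : 'S_r, multi_perm f s \in nondecr_tuples d r.
Proof.
pose T := [tuple f t | t < r]; pose le := (fun i j : 'I_d => (i <= j)%N).
have /tuple_permP[s Ts] : perm_eq (sort le T) T by rewrite perm_sort.
exists s; rewrite nondecr_sorted /multi_seq.
have -> : [seq val (multi_perm f s t) | t <- enum 'I_r] =
          map val (sort le T).
  rewrite Ts /= -[RHS]map_comp; apply: eq_map => t; rewrite /= ffunE.
  by rewrite tnth_mktuple.
rewrite sorted_map; apply: sort_sorted => i j; exact: leq_total.
Qed.

Section Basis.
Variables (R : realType) (d r : nat) (chi : 'S_r -> R[i]).
Hypothesis chiM : forall s t, chi (s * t)%g = chi s * chi t.
Hypothesis chi2 : forall s, chi s * chi s = 1.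
Hypothesis chi_conj : forall s, (chi s)^* = chi s.

Definition chi_sum (g : multi d r) : 'cV[R[i]]_#|multi d r| :=
  \sum_(s : 'S_r) chi s *: tensor_elt R (multi_perm g s).
Local Notation u := chi_sum.

Variables (S : {set multi d r}) (c : multi d r -> R[i]).
Hypothesis S_unique : forall g h s t, g \in S -> h \in S ->
  multi_perm g s = multi_perm h t -> g = h.
Hypothesis S_exists : forall f, u f = 0 \/ exists s, multi_perm f s \in S.
Hypothesis c_norm : forall g, g \in S -> (c g)^* * c g * (u g ^t* *m u g) 0 0 = 1.

Let W : 'M[R[i]]_(#|multi d r|, #|S|) :=
  \matrix_(i, j) (c (enum_val j) *: u (enum_val j)) i 0.

Let chi1 : chi 1%g = 1.
Proof. by rewrite -[RHS](chi2 1%g) -chiM mulg1. Qed.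

Let chiV s : chi s^-1%g = chi s.
Proof. by rewrite -[LHS]mulr1 -(chi2 s) mulrA -chiM mulVg chi1 mul1r. Qed.

Lemma chi_sumE g (f : multi d r) :
  u g (enum_rank f) 0 = \sum_(s | multi_perm g s == f) chi s.
Proof.
rewrite /chi_sum summxE [RHS]big_mkcond /=; apply: eq_bigr => s _.
rewrite !mxE eqxx andbT (inj_eq enum_rank_inj) eq_sym.
by case: eqP; rewrite ?mulr1 ?mulr0.
Qed.

Lemma chi_sumP f s : u (multi_perm f s) = chi s *: u f.
Proof.
rewrite /chi_sum scaler_sumr (reindex_inj (mulIg s^-1%g)) /=.
apply: eq_bigr => t _; rewrite multi_permM mulgKV scalerA chiM chiV.
by rewrite mulrC.
Qed.

Lemma basis_orthonormal : W ^t* *m W = 1%:M.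
Proof.
apply/matrixP => i j; rewrite !mxE.
transitivity ((c (enum_val i))^* * c (enum_val j) *
   (u (enum_val i) ^t* *m u (enum_val j)) 0 0).
  rewrite !mxE mulr_sumr; apply: eq_bigr => k _; rewrite !mxE rmorphM /=.
  by rewrite mulrACA.
have [->|ij] := eqVneq i j; first by rewrite c_norm ?enum_valP.
rewrite mxE big1 ?mulr0 // => k _; rewrite !mxE.
rewrite -(enum_valK k) !chi_sumE.
have [s /eqP sk|nk] := pickP [pred s | multi_perm (enum_val i) s == enum_val k].
  rewrite [X in _ * X]big1 ?mulr0 // => t /eqP tk.
  case/eqP: ij; apply: enum_val_inj; apply: (@S_unique _ _ s t);
    rewrite ?enum_valP // sk tk //.
by rewrite big_pred0 ?rmorph0 ?mul0r.
Qed.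

Let equivariant (w : 'cV[R[i]]_#|multi d r|) :=
  forall f s, w (enum_rank (multi_perm f s)) 0 = chi s * w (enum_rank f) 0.

Let tensorP (A : 'M[R[i]]_d) f s g :
  tensor_pow r A (enum_rank (multi_perm f s)) (enum_rank (multi_perm g s)) =
  tensor_pow r A (enum_rank f) (enum_rank g).
Proof.
rewrite !mxE !enum_rankK [RHS](reindex_inj (@perm_inj _ s)).
by apply: eq_bigr => t _; rewrite !ffunE.
Qed.

Let rank_perm_bij s :
  bijective (fun k : 'I_#|multi d r| => enum_rank (multi_perm (enum_val k) s)).
Proof.
exists (fun k => enum_rank (multi_perm (enum_val k) s^-1%g)) => k;
  by rewrite enum_rankK multi_permM ?mulVg ?mulgV multi_perm1 enum_valK.
Qed.

Let equivariant_u g : equivariant (u g).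
Proof.
move=> f s; rewrite !chi_sumE mulr_sumr (reindex_inj (mulgI s)) /=.
apply: eq_big => [t|t _]; last by rewrite chiM.
rewrite -multi_permM; apply/eqP/eqP => [h|->//].
by rewrite -[LHS]multi_perm1 -(mulVg s) -multi_permM h multi_permM mulVg multi_perm1.
Qed.

Lemma chi_sum_norm g :
  (u g ^t* *m u g) 0 0 = (r`!)%:R * u g (enum_rank g) 0.
Proof.
rewrite mxE.
transitivity (\sum_k \sum_s (chi s * tensor_elt R (multi_perm g s) k 0) * u g k 0).
  apply: eq_bigr => k _; rewrite !mxE {1}/chi_sum summxE rmorph_sum /= mulr_suml.
  by apply: eq_bigr => s _; rewrite !mxE rmorphM /= chi_conj rmorph_nat.
rewrite exchange_big /= -card_Sn mulr_natl -sumr_const.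
apply: eq_bigr => s _; rewrite (bigD1 (enum_rank (multi_perm g s))) //= !mxE.
rewrite !eqxx mulr1 big1 ?addr0 => [|k /negPf ks].
  by rewrite equivariant_u mulrA chi2 mul1r.
by rewrite !mxE ks mulr0 mul0r.
Qed.

Let equivariant_T A w : equivariant w -> equivariant (tensor_pow r A *m w).
Proof.
move=> ew f s; rewrite mxE (reindex _ (onW_bij _ (rank_perm_bij s))) /=.
rewrite [X in _ * X]mxE mulr_sumr; apply: eq_bigr => k _.
by rewrite tensorP ew enum_valK mulrCA.
Qed.

Let equivariant_span w : equivariant w -> exists z, w = W *m z.
Proof.
move=> ew.
have span_u f : exists z, u f = W *m z.
  case: (S_exists f) => [->|[s sS]]; first by exists 0; rewrite mulmx0.
  have c0 : c (multi_perm f s) != 0.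
    apply/eqP => c0; have := c_norm sS.
    by rewrite c0 mulr0 mul0r => /esym/eqP; rewrite oner_eq0.
  exists ((chi s / c (multi_perm f s)) *: delta_mx (enum_rank_in sS (multi_perm f s)) 0).
  rewrite -scalemxAr -colE; apply/matrixP => i j; rewrite !mxE ord1.
  rewrite enum_rankK_in // chi_sumP mxE [chi s * _ * _]mulrA.
  by rewrite divfK // mulrA chi2 mul1r.
have span_sum (F : multi d r -> 'cV[R[i]]_#|multi d r|) :
    (forall f, exists z, F f = W *m z) -> exists z, \sum_f F f = W *m z.
  move=> hF; apply: (big_ind (fun v => exists z, v = W *m z)) => //.
  - by exists 0; rewrite mulmx0.
  - by move=> _ _ [x ->] [y ->]; exists (x + y); rewrite mulmxDr.
have rn0 : (r`!)%:R != 0 :> R[i] by rewrite pnatr_eq0 -lt0n fact_gt0.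
have -> : w = \sum_f ((r`!)%:R^-1 * w (enum_rank f) 0) *: u f.
  apply: (scalerI rn0); rewrite scaler_sumr.
  transitivity (\sum_(s : 'S_r) w).
    by rewrite sumr_const card_Sn scaler_nat.
  under [RHS]eq_bigr => f _ do rewrite scalerA mulVKf // /chi_sum scaler_sumr.
  rewrite exchange_big /=; apply: eq_bigr => s _.
  have inj_s : injective (fun f : multi d r => multi_perm f s^-1%g).
    by move=> f g /(congr1 (fun h : multi d r => multi_perm h s)); rewrite !multi_permM mulgV !multi_perm1.
  rewrite (reindex_inj inj_s) /=.
  under eq_bigr => f _ do
    rewrite multi_permM mulgV multi_perm1 scalerA ew chiV mulrAC chi2 mul1r.
  apply/matrixP => i j; rewrite ord1 summxE (bigD1 (enum_val i)) //= !mxE.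
  rewrite enum_valK !eqxx mulr1 big1 ?addr0 // => f fi.
  rewrite !mxE andbT -(inj_eq enum_val_inj) enum_rankK eq_sym.
  by rewrite (negPf fi) mulr0.
apply: span_sum => f; have [z ->] := span_u f.
by exists (((r`!)%:R^-1 * w (enum_rank f) 0) *: z); rewrite scalemxAr.
Qed.

Lemma basis_stable (A : 'M[R[i]]_d) :
  tensor_pow r A *m W = W *m (W ^t* *m tensor_pow r A *m W).
Proof.
have fix_w w : equivariant w -> W *m (W ^t* *m w) = w.
  by case/equivariant_span => z ->; rewrite !mulmxA -(mulmxA W) basis_orthonormal mulmx1.
apply/matrixP => i j.
rewrite -!(mulmxA _ (tensor_pow r A)).
have colW : col j (tensor_pow r A *m W) =
            c (enum_val j) *: (tensor_pow r A *m u (enum_val j)).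
  rewrite scalemxAr; apply/matrixP => k l; rewrite !mxE.
  by apply: eq_bigr => m _; rewrite !mxE ord1.
have ej : equivariant (col j (tensor_pow r A *m W)).
  rewrite colW => f s; have := equivariant_T A (@equivariant_u (enum_val j)) f s.
  by move=> e; rewrite [LHS]mxE e mulrCA; congr (_ * _); rewrite [RHS]mxE.
have := fix_w _ ej => /matrixP/(_ i 0).
rewrite [in X in X -> _]colE.
rewrite (mulmxA _ _ (delta_mx _ _)) (mulmxA W) -!colE mxE [in RHS]mxE.
by move=> <-; rewrite -mulmxA mxE; apply: eq_bigr => k _; rewrite [col _ _ _ _]mxE.
Qed.

End Basis.

Section Wedge.
Variables (R : realType) (d r : nat).

Let chi (s : 'S_r) : R[i] := (-1) ^+ s.
Let c (g : multi d r) : R[i] := (sqrtC (r`!)%:R)^-1.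

Let chiM s t : chi (s * t)%g = chi s * chi t.
Proof. by rewrite /chi odd_permM signr_addb. Qed.

Let chi2 s : chi s * chi s = 1.
Proof. by rewrite -expr2 sqrr_sign. Qed.

Let chi_conj s : (chi s)^* = chi s.
Proof. by rewrite /chi rmorph_sign. Qed.

Let unique (g h : multi d r) s t :
  g \in incr_tuples d r -> h \in incr_tuples d r ->
  multi_perm g s = multi_perm h t -> g = h.
Proof.
rewrite !incr_nondecr => /andP[gS _] /andP[hS _] gh.
apply: (@nondecr_unique _ _ _ _ (t^-1 * s)%g gS hS).
by rewrite -multi_permM gh multi_permM mulVg multi_perm1.
Qed.

Let exist (f : multi d r) :
  chi_sum chi f = 0 \/ exists s, multi_perm f s \in incr_tuples d r.
Proof.
have [fI|] := boolP (injectiveb f).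
  right; have [s sP] := nondecr_exists f; exists s.
  rewrite incr_nondecr sP /=; apply/injectiveP => i j; rewrite !ffunE.
  by move/(injectiveP _ fI)/perm_inj.
case/injectivePn => i [j ij fij]; left.
have ft : multi_perm f (tperm i j) = f.
  by apply/ffunP => t; rewrite ffunE; case: tpermP => // ->.
have := chi_sumP chiM chi2 f (tperm i j).
rewrite ft /chi odd_tperm ij expr1 scaleN1r => /eqP.
rewrite -addr_eq0 -mulr2n -scaler_nat scaler_eq0 pnatr_eq0 /=.
by move/eqP.
Qed.

Let norm (g : multi d r) : g \in incr_tuples d r ->
  (c g)^* * c g * ((chi_sum chi g) ^t* *m chi_sum chi g) 0 0 = 1.
Proof.
rewrite incr_nondecr => /andP[_ /injectiveP gI].
rewrite chi_sum_norm // chi_sumE (bigD1 1%g) ?multi_perm1 //=.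
rewrite big1 => [|s /andP[/eqP gs]]; last first.
  case/eqP; apply/permP => t; apply: gI; rewrite perm1.
  by move/ffunP/(_ t): gs; rewrite ffunE.
rewrite addr0 /chi odd_perm1 expr0 mulr1 /c.
have fn0 : (r`!)%:R != 0 :> R[i] by rewrite pnatr_eq0 -lt0n fact_gt0.
rewrite geC0_conj ?invr_ge0 ?sqrtC_ge0 ?ler0n // -expr2 exprVn sqrtCK.
by rewrite mulVf.
Qed.

Let wedge_basisE : wedge_basis R d r =
  \matrix_(i, j) (c (enum_val j) *: chi_sum chi (enum_val j)) i 0.
Proof. by []. Qed.

Lemma wedge_basis_orthonormal :
  (wedge_basis R d r) ^t* *m wedge_basis R d r = 1%:M.
Proof. rewrite wedge_basisE; exact: basis_orthonormal. Qed.

Lemma ext_powP (A : 'M[R[i]]_d) :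
  tensor_pow r A *m wedge_basis R d r = wedge_basis R d r *m ext_pow r A.
Proof. rewrite /ext_pow wedge_basisE; exact: basis_stable. Qed.

End Wedge.

Section Symmetric.
Variables (R : realType) (d r : nat).

Let chi (s : 'S_r) : R[i] := 1.
Let c (g : multi d r) : R[i] := (hnorm (symmetrized R g))^-1 * (r`!%:R)^-1.

Let chiM s t : chi (s * t)%g = chi s * chi t.
Proof. by rewrite /chi mulr1. Qed.

Let chi2 s : chi s * chi s = 1.
Proof. by rewrite /chi mulr1. Qed.

Let chi_conj s : (chi s)^* = chi s.
Proof. by rewrite /chi rmorph1. Qed.

Let unique (g h : multi d r) s t :
  g \in nondecr_tuples d r -> h \in nondecr_tuples d r ->
  multi_perm g s = multi_perm h t -> g = h.
Proof.
move=> gS hS gh; apply: (@nondecr_unique _ _ _ _ (t^-1 * s)%g gS hS).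
by rewrite -multi_permM gh multi_permM mulVg multi_perm1.
Qed.

Let exist (f : multi d r) :
  chi_sum chi f = 0 \/ exists s, multi_perm f s \in nondecr_tuples d r.
Proof. by right; exact: nondecr_exists. Qed.

Let symmetrizedE (g : multi d r) : symmetrized R g = (r`!%:R)^-1 *: chi_sum chi g.
Proof.
by congr (_ *: _); apply: eq_bigr => s _; rewrite scale1r.
Qed.

Let norm (g : multi d r) : g \in nondecr_tuples d r ->
  (c g)^* * c g * ((chi_sum chi g) ^t* *m chi_sum chi g) 0 0 = 1.
Proof.
move=> _.
have fn0 : (r`!)%:R != 0 :> R[i] by rewrite pnatr_eq0 -lt0n fact_gt0.
set N := (_ *m _) 0 0.
have N_gt0 : 0 < N.
  rewrite /N chi_sum_norm // chi_sumE (bigD1 1%g) ?multi_perm1 //=.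
  rewrite mulr_gt0 ?ltr0n ?fact_gt0 // ltr_wpDr ?ltr01 //.
  by apply: sumr_ge0 => s _; rewrite ler01.
have vN : ((symmetrized R g) ^t* *m symmetrized R g) 0 0 = (r`!%:R) ^- 2 * N.
  rewrite symmetrizedE /N !mxE mulr_sumr; apply: eq_bigr => k _.
  by rewrite !mxE rmorphM /= fmorphV rmorph_nat mulrACA -expr2 exprVn.
have v_ge0 : 0 <= (r`!%:R) ^- 2 * N.
  by rewrite mulr_ge0 ?(ltW N_gt0) // invr_ge0 exprn_ge0 ?ler0n.
rewrite /c /hnorm vN geC0_conj; last first.
  by rewrite mulr_ge0 ?invr_ge0 ?sqrtC_ge0 ?ler0n.
rewrite -expr2 exprMn exprVn sqrtCK exprVn invfM invrK.
by rewrite [_ ^+ 2 / N]mulrC mulfK ?expf_neq0 // mulVf ?gt_eqF.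
Qed.

Let sym_basisE : sym_basis R d r =
  \matrix_(i, j) (c (enum_val j) *: chi_sum chi (enum_val j)) i 0.
Proof.
apply/matrixP => i j; rewrite [LHS]mxE [RHS]mxE /sym_elt {2}symmetrizedE.
by rewrite scalerA.
Qed.

Lemma sym_basis_orthonormal :
  (sym_basis R d r) ^t* *m sym_basis R d r = 1%:M.
Proof. rewrite sym_basisE; exact: basis_orthonormal. Qed.

Lemma sym_powP (A : 'M[R[i]]_d) :
  tensor_pow r A *m sym_basis R d r = sym_basis R d r *m sym_pow r A.
Proof. rewrite /sym_pow sym_basisE; exact: basis_stable. Qed.

End Symmetric.

(* Main.v *)
Require Import Defs.
From mathcomp Require Import all_boot all_order all_algebra all_fingroup.
From mathcomp Require Import spectral sesquilinear.
From mathcomp Require Import complex reals.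
From mathcomp Require Import ring lra.

(** Write rho for the exterior or symmetric power representation and let [x_I],
    [y_I] be the products of the singular values of [A], [B] along a tuple [I].
    By singular value decompositions and the AM-GM inequality, the sum of the [k]
    largest singular values of [rho A + rho B] is bounded by averages of
    [sum_I x_I p_I + y_I q_I], where [p_I] and [q_I] are the squared lengths of
    the [I]-th rows of [rho U X] and [rho V X], with [U], [V] unitary and [X] an
    orthonormal [k]-frame.

    The weights satisfy [p(D) + q(D') <= k + |D n D'|] for down-sets [D], [D'] of
    tuples.  Indeed the [D, D'] block of [rho W], [W = U V^-1], has rank at most
    [|D n D'|]: for [W = L M] with [L] lower and [M] upper triangular it factors
    through the coordinates in [D n D'], and a generic shift of [W] has such a
    factorization, while rank can only drop under specialization.

    If [F] is a set of [k] indices maximizing the sum of [x + y] and [t] is the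
    threshold of [F], then the level sets [D = {x > s}] and [D' = {y >= t - s}]
    satisfy [D n D' <= F <= D u D'], whence
    [p(D) + q(D') <= |F n D| + |F n D'|]; integrating over [s] gives the claim. *)

Set Implicit Arguments.
Unset Strict Implicit.
Unset Printing Implicit Defensive.

Import Order.TTheory GRing.Theory Num.Theory.
Local Open Scope ring_scope.
Local Open Scope sesquilinear_scope.

Local Notation cmx x := (map_mx (real_complex _) x).

(** * Coupled level sets *)

(** Going down the decreasing list, each value [v] contributes the pair [(v, t - v)], its gap to the
    previous value; the last pair starts at 0. Ties give gaps of length zero, which the clause
    [sc.2 != 0 -> sc.1 < t] has to exempt. *)
Lemma step_decomposition_path (R : realFieldType) (l : seq R) (t : R) :
  0 <= t -> path >=%R t l -> all (>= 0) l ->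
  exists ps : seq (R * R),
    [/\ forall sc, sc \in ps -> 0 <= sc.1 /\ 0 <= sc.2 /\ (sc.2 != 0 -> sc.1 < t),
        \sum_(sc <- ps) sc.2 = t &
        forall v, v \in l -> \sum_(sc <- ps | sc.1 < v) sc.2 = v].
Proof.
elim: l t => [|v l IH] t t0 /=.
  move=> _ _; exists [:: (0, t)]; split => //; last by rewrite big_seq1.
  by move=> sc; rewrite inE => /eqP -> /=; rewrite lt0r t0 andbT.
case/andP => vt pl /andP[v0 l0].
have [ps [ps_ge ps_sum ps_lt]] := IH v v0 pl l0.
have le_l : forall u, u \in l -> u <= v.
  move=> u; have /allP h := order_path_min (rev_trans le_trans) pl.
  by move/h.
exists ((v, t - v) :: ps); split.
- move=> sc; rewrite inE => /predU1P[->|/ps_ge[s0 [c0 lt_s]]] /=.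
    rewrite subr_ge0 v0 vt; split => //; split => //.
    by rewrite subr_eq0 lt_def vt andbT.
  by do 2?split => //; move/lt_s => h; apply: lt_le_trans vt.
- by rewrite big_cons ps_sum /= subrK.
move=> u; rewrite inE => /predU1P[->|ul]; rewrite big_cons /=.
  (* At [u = v] the condition [sc.1 < v] discards only gaps of length zero. *)
  rewrite ltxx big_mkcond /= -[RHS]ps_sum big_seq [RHS]big_seq.
  apply: eq_bigr => sc /ps_ge [_ [_ lt_s]].
  by case: eqP lt_s => [->|_ ->//]; rewrite if_same.
by rewrite ltNge (le_l _ ul) /= ps_lt.
Qed.

(* The points [sc.1] and gaps [sc.2] of a subdivision of [0, t] through all the
   values in [l]: a finite stand-in for integration over [0, t]. *)
Lemma step_decomposition (R : realFieldType) (l : seq R) (t : R) :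
  0 <= t -> (forall v, v \in l -> 0 <= v <= t) ->
  exists ps : seq (R * R),
    [/\ forall sc, sc \in ps -> 0 <= sc.1 /\ 0 <= sc.2 /\ (sc.2 != 0 -> sc.1 < t),
        \sum_(sc <- ps) sc.2 = t &
        forall v, v \in l -> \sum_(sc <- ps | sc.1 < v) sc.2 = v].
Proof.
move=> t0 hl; have [||ps [h1 h2 h3]] := @step_decomposition_path R (sort >=%R l) t t0.
- rewrite (path_sortedE (rev_trans le_trans)); apply/andP; split.
    by apply/allP => v; rewrite mem_sort => /hl/andP[].
  by apply: sort_sorted => u v; exact: le_total.
- by apply/allP => v; rewrite mem_sort => /hl/andP[].
by exists ps; split => // v vl; apply: h3; rewrite mem_sort.
Qed.

(** Layer-cake formula: after exchanging the sums, each [I] collects the gaps below [x I]. *)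
Lemma sum_step (R : realFieldType) (T : finType) (P : pred T) (x w : T -> R) (ps : seq (R * R)) :
  (forall I, \sum_(sc <- ps | sc.1 < x I) sc.2 = x I) ->
  \sum_(sc <- ps) sc.2 * (\sum_(I | P I && (sc.1 < x I)) w I) = \sum_(I | P I) x I * w I.
Proof.
move=> hx.
transitivity (\sum_(sc <- ps) \sum_(I | P I) (if sc.1 < x I then sc.2 * w I else 0)).
  by apply: eq_bigr => sc _; rewrite mulr_sumr big_mkcondr.
rewrite exchange_big /=; apply: eq_bigr => I _.
by rewrite -[in RHS](hx I) mulr_suml -big_mkcond.
Qed.

(** The counterpart for levels measured down from [t]: the gaps starting at or above [t - y I] add
    up to [y I]. *)
Lemma sum_costep (R : realFieldType) (T : finType) (P : pred T) (t : R) (y w : T -> R)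
    (ps : seq (R * R)) :
  \sum_(sc <- ps) sc.2 = t ->
  (forall I, \sum_(sc <- ps | sc.1 < t - y I) sc.2 = t - y I) ->
  \sum_(sc <- ps) sc.2 * (\sum_(I | P I && (t - sc.1 <= y I)) w I) =
  \sum_(I | P I) y I * w I.
Proof.
move=> ht hy.
transitivity (\sum_(sc <- ps) \sum_(I | P I) (if t - sc.1 <= y I then sc.2 * w I else 0)).
  by apply: eq_bigr => sc _; rewrite mulr_sumr big_mkcondr.
rewrite exchange_big /=; apply: eq_bigr => I _.
have yE : y I = \sum_(sc <- ps | t - sc.1 <= y I) sc.2.
  rewrite [RHS](eq_bigl (fun sc => ~~ (sc.1 < t - y I))) => [|sc]; last first.
    by rewrite -leNgt lerBlDr lerBlDl.
  by move: ht; rewrite (bigID (fun sc => sc.1 < t - y I)) /= hy; lra.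
by rewrite [X in _ = X * _]yE mulr_suml -big_mkcond.
Qed.

(* The level sets of [x] at [s] and of [y] at [t - s] are coupled, so that their
   intersection lies in [F] and their union contains [F]; hence [F] is optimal
   for every pair of levels at once. *)
Lemma coupled_levels_le (R : realFieldType) (T : finType) (x y p q : T -> R)
    (F : {set T}) (t : R) :
  0 <= t -> (forall I, 0 <= x I) -> (forall I, 0 <= y I) ->
  (forall I, p I <= 1) -> (forall I, q I <= 1) ->
  (forall I, I \in F -> t <= x I + y I) ->
  (forall I, I \notin F -> x I + y I <= t) ->
  (forall s, \sum_(I | s < x I) p I + \sum_(I | t - s <= y I) q I <=
     #|F|%:R + #|[set I | s < x I & t - s <= y I]|%:R) ->
  \sum_I x I * p I + \sum_I y I * q I <= \sum_(I in F) (x I + y I).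
Proof.
move=> t0 x0 y0 p1 q1 Fin Fout key.
(* Levels run over [0, t] only, so both functions are truncated at [t]. The excess above [t] lives
   on [F] and is bounded separately by [high]. *)
pose x' I := Num.min (x I) t; pose y' I := Num.min (y I) t.
pose l := [seq x' J | J <- enum T] ++ [seq t - y' J | J <- enum T].
have [v|ps [ps_ge ps_sum ps_lt]] := @step_decomposition R l t t0.
  rewrite mem_cat => /orP[]/mapP[I _ ->]; rewrite /x' /y'.
    by rewrite le_min x0 t0 ge_min lexx orbT.
  by rewrite subr_ge0 ge_min lexx orbT lerBlDr lerDl le_min y0 t0.
have hx I : \sum_(sc <- ps | sc.1 < x' I) sc.2 = x' I.
  by apply: ps_lt; rewrite mem_cat map_f ?mem_enum.
have hy I : \sum_(sc <- ps | sc.1 < t - y' I) sc.2 = t - y' I.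
  by apply: ps_lt; rewrite mem_cat [X in _ || X]map_f ?orbT ?mem_enum.
have low : \sum_I x' I * p I + \sum_I y' I * q I <=
           \sum_(I in F) x' I * 1 + \sum_(I in F) y' I * 1.
  rewrite -!(sum_step _ _ hx) -!(sum_costep _ _ ps_sum hy) -!big_split /= big_seq [leRHS]big_seq.
  apply: ler_sum => sc /ps_ge [s0 [c0 lt_s]].
  have [->|cn0] := eqVneq sc.2 0; first by rewrite !mul0r.
  rewrite -!mulrDr; apply: ler_wpM2l => //.
  have st := lt_s cn0; set s := sc.1 in s0 st *.
  have Ex I : (s < x' I) = (s < x I) by rewrite /x' lt_min st andbT.
  have Ey I : (t - s <= y' I) = (t - s <= y I).
    by rewrite /y' le_min [X in _ && X]lerBlDr lerDl s0 andbT.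
  rewrite (eq_bigl (fun I => s < x I)) => [|I]; last by rewrite Ex.
  rewrite (eq_bigl (fun I => t - s <= y I) q) => [|I]; last by rewrite Ey.
  apply: le_trans (key s) _.
  (* With D = {s < x} and D' = {t - s <= y}, equality holds: |F| + |D n D'| = |F n D| + |F n D'|,
     because D n D' lies in [F] and the part of [F] outside D lies in D'. One strict and one weak
     level make both inclusions survive ties at [t]. *)
  rewrite !sumr_const -!natrD ler_nat.
  rewrite -(cardsID [set I | s < x I] F) addnAC leq_eqVlt; apply/orP; left; apply/eqP.
  set a := #|F :\: _|; set b := #|F :&: _|.
  have -> : #|[pred I | (I \in F) && (s < x' I)]| = b.
    by apply: eq_card => I; rewrite !inE Ex.
  rewrite -addnA; congr (_ + _)%N.
  have -> : #|[pred I | (I \in F) && (t - s <= y' I)]| =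
     #|[set I in F | t - s <= y I]| by apply: eq_card => I; rewrite !inE Ey.
  rewrite -[RHS](cardsID [set I | s < x I]); congr (_ + _)%N; apply: eq_card => I; rewrite !inE.
    case: (boolP (I \in F)) => [_|/Fout h] /=; first by rewrite andbC.
    by apply/negbTE/negP => /andP[]; lra.
  case: (boolP (I \in F)) => [/Fin h|_] /=; rewrite ?andbF //.
  by case: (ltP s (x I)) => //= h2; symmetry; rewrite lerBlDr; lra.
have high (z w : T -> R) : (forall I, w I <= 1) -> (forall I, z I > t -> I \in F) ->
    \sum_I (z I - Num.min (z I) t) * w I <= \sum_(I in F) (z I - Num.min (z I) t).
  move=> w1 zF; rewrite [leRHS]big_mkcond; apply: ler_sum => I _.
  have zt : 0 <= z I - Num.min (z I) t by rewrite subr_ge0 ge_min lexx.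
  case: ifPn => [_|]; first by rewrite ler_piMr.
  move/(contra (zF I)); rewrite -leNgt => /min_idPl ->.
  by rewrite subrr mul0r.
have hix := high x p p1; have hiy := high y q q1.
have h (z w : T -> R) : \sum_I z I * w I =
    \sum_I Num.min (z I) t * w I + \sum_I (z I - Num.min (z I) t) * w I.
  by rewrite -big_split /=; apply: eq_bigr => I _; rewrite -mulrDl addrC subrK.
rewrite (h x) (h y) addrACA.
have -> : \sum_(I in F) (x I + y I) =
   (\sum_(I in F) x' I * 1 + \sum_(I in F) y' I * 1) +
   (\sum_(I in F) (x I - x' I) + \sum_(I in F) (y I - y' I)).
  by rewrite -!big_split /=; apply: eq_bigr => I _; ring.
apply: lerD => //; apply: lerD; [apply: hix | apply: hiy] => I xt.
  by apply: contraLR xt => /Fout; rewrite -leNgt; have := y0 I; lra.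
by apply: contraLR xt => /Fout; rewrite -leNgt; have := x0 I; lra.
Qed.

(** * Minors, LU decompositions and coordinate projections *)

Lemma nonzero_minor (F : fieldType) (m n : nat) (M : 'M[F]_(m, n)) :
  exists (f : 'I_(\rank M) -> 'I_m) (g : 'I_(\rank M) -> 'I_n), \det (mxsub f g M) != 0.
Proof.
pose f := maxrankfun M.
have full : row_full (rowsub f M)^T.
  by rewrite /row_full mxrank_tr -/(row_free _) maxrowsub_free.
exists f, (fullrankfun full); rewrite -unitfE -unitmxE -unitmx_tr.
have := fullrowsub_unit full; congr (_ \in unitmx).
by apply/matrixP => i j; rewrite !mxE.
Qed.

Lemma mxrank_minor (F : fieldType) (k m n : nat) (M : 'M[F]_(m, n))
    (f : 'I_k -> 'I_m) (g : 'I_k -> 'I_n) :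
  \det (mxsub f g M) != 0 -> (k <= \rank M)%N.
Proof.
rewrite -unitfE -unitmxE => /mxrank_unit <-.
have -> : mxsub f g M = rowsub f M *m colsub g 1%:M.
  apply/matrixP => i j; rewrite !mxE (bigD1 (g j)) //= !mxE eqxx mulr1.
  by rewrite big1 ?addr0 // => l /negbTE lg; rewrite !mxE lg mulr0.
by rewrite rowsubE -mulmxA; apply: leq_trans (mxrankM_maxr _ _) (mxrankM_maxl _ _).
Qed.

Lemma invmx_trig (F : fieldType) (n : nat) (K : 'M[F]_n) :
  is_trig_mx K -> (forall i, K i i = 1) -> K \in unitmx /\ is_trig_mx (invmx K).
Proof.
move=> /is_trig_mxP Kt K1.
have Ku : K \in unitmx.
  by rewrite unitmxE det_trig ?big1 ?unitr1 //; apply/is_trig_mxP.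
split => //; apply/is_trig_mxP => i.
(* The columns are treated from the last one backwards; [m] bounds [n - j]. *)
have main m : forall j : 'I_n, (i < j)%N -> (n <= j + m)%N -> invmx K i j = 0.
  elim: m => [|m IH] j ij; first by rewrite addn0 leqNgt ltn_ord.
  move=> jm; have := mulVmx Ku => /matrixP/(_ i j); rewrite !mxE.
  rewrite [i == j](_ : _ = false); last by apply: contraTF ij => /eqP ->; rewrite ltnn.
  rewrite (bigD1 j) //= K1 mulr1 big1 ?addr0 // => l lj.
  case: (ltngtP l j) => [lt|gt|/val_inj e]; first by rewrite Kt ?mulr0.
    rewrite IH ?mul0r //; first exact: ltn_trans gt.
    by rewrite addnS -addSn in jm; apply: leq_trans jm _; rewrite leq_add2r.
  by rewrite e eqxx in lj.
by move=> j ij; apply: (main n) => //; rewrite leq_addl.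
Qed.

(** Multiplying by it on the left and by its transpose on the right cuts out the leading [i] by [i]
    block when [i <= d]. *)
Definition lead_incl (F : fieldType) (i d : nat) : 'M[F]_(i, d) :=
  \matrix_(a, b) (val a == val b)%:R.

Lemma lead_inclK (F : fieldType) (i d : nat) : (i <= d)%N ->
  lead_incl F i d *m (lead_incl F i d)^T = 1%:M.
Proof.
move=> id; apply/matrixP => a b; rewrite !mxE (bigD1 (widen_ord id a)) //= !mxE eqxx mul1r.
rewrite big1 => [|l /negbTE la]; last first.
  by rewrite !mxE (_ : (val a == val l) = false) ?mul0r // -la eq_sym.
by rewrite addr0 /= eq_sym -val_eqE.
Qed.

(** Gaussian elimination in closed form: [v i] is the basis vector [i] corrected by earlier ones so
    that [v i *m W] vanishes in the columns before [i]. These rows form a unit lower triangular [K]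
    with [K *m W] upper triangular. The minors involved have sizes 0 to [d - 1]. *)
Lemma LU_decomposition (F : fieldType) (d : nat) (W : 'M[F]_d) :
  (forall i : 'I_d, \det (lead_incl F i d *m W *m (lead_incl F i d)^T) != 0) ->
  exists L U : 'M[F]_d, [/\ W = L *m U, is_trig_mx L & is_trig_mx U^T].
Proof.
move=> minors.
pose E (i : 'I_d) := lead_incl F i d.
pose v (i : 'I_d) : 'rV_d := delta_mx 0 i -
   (delta_mx 0 i *m W *m (E i)^T) *m invmx (E i *m W *m (E i)^T) *m E i.
have vW (i j : 'I_d) : (j < i)%N -> (v i *m W) 0 j = 0.
  move=> ji; have : v i *m W *m (E i)^T = 0.
    have u : E i *m W *m (E i)^T \in unitmx by rewrite unitmxE unitfE minors.
    by rewrite /v !mulmxBl -(mulmxA _ (E i) W) -(mulmxA _ (E i *m W)) mulmxKV ?subrr.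
  move/matrixP/(_ 0 (Ordinal ji)); rewrite [RHS]mxE => <-; rewrite [RHS]mxE (bigD1 j) //=.
  have EE l : (E i)^T l (Ordinal ji) = (l == j)%:R by rewrite !mxE /= eq_sym.
  by rewrite EE eqxx mulr1 big1 ?addr0 // => l /negbTE lj; rewrite EE lj mulr0.
have vE (i j : 'I_d) : (i <= j)%N -> v i 0 j = (i == j)%:R.
  move=> ij; rewrite !mxE eqxx eq_sym big1 ?subr0 // => l _; rewrite !mxE.
  case: eqP => [/= lj|]; last by rewrite mulr0.
  by have := ltn_ord l; rewrite lj ltnNge ij.
pose K := \matrix_i v i.
have KE i j : K i j = v i 0 j by rewrite mxE.
have [||Ku Kt] := @invmx_trig F d K.
- apply/is_trig_mxP => i j ij; rewrite KE vE ?(ltnW ij) //.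
  by rewrite (_ : (_ == _) = false) //; apply: contraTF ij => /eqP ->; rewrite ltnn.
- by move=> i; rewrite KE vE ?eqxx.
exists (invmx K), (K *m W); split => //; first by rewrite mulKmx.
apply/is_trig_mxP => i j ij; rewrite mxE -(vW j i ij) !mxE.
by apply: eq_bigr => l _; rewrite KE.
Qed.

(** As a polynomial in [e], each leading minor of [W + e%:M] is the characteristic polynomial of
    minus the leading block, hence monic; so [e] can avoid the roots of all of them and of [q]. *)
Lemma generic_shift_LU (F : closedFieldType) (d : nat) (W : 'M[F]_d) (q : {poly F}) :
  q != 0 -> exists e : F, q.[e] != 0 /\
    exists L U : 'M[F]_d, [/\ W + e%:M = L *m U, is_trig_mx L & is_trig_mx U^T].
Proof.
move=> q0.
pose m (i : 'I_d) := char_poly (- (lead_incl F i d *m W *m (lead_incl F i d)^T)).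
have : q * \prod_i m i != 0.
  rewrite mulf_neq0 //; apply/prodf_neq0 => i _; exact/monic_neq0/char_poly_monic.
case/closed_nonrootP => e; rewrite rootE hornerM mulf_eq0 negb_or => /andP[qe me].
exists e; split => //; apply: LU_decomposition => i.
move: me; rewrite horner_prod => /prodf_neq0/(_ i isT); congr (_ != 0).
rewrite /m /char_poly -[LHS]/(horner_eval e _) -det_map_mx; congr (\det _).
rewrite mulmxDr mulmxDl scalar_mxC -[e%:M *m _ *m _]mulmxA lead_inclK ?mulmx1; last exact: ltnW.
move: (_ *m W *m _) => N; apply/matrixP => a b.
rewrite !mxE /= /horner_eval hornerD hornerN hornerC hornerMn hornerX.
by rewrite opprK addrC.
Qed.

Section CoordProj.
Variables (F : comNzRingType) (n : nat).

Definition coord_proj (D : {set 'I_n}) : 'M[F]_n := diag_mx (\row_i (i \in D)%:R).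

Lemma coord_projE D m (M : 'M[F]_(n, m)) i j :
  (coord_proj D *m M) i j = if i \in D then M i j else 0.
Proof. by rewrite mul_diag_mx !mxE; case: ifP; rewrite ?mul1r ?mul0r. Qed.

Lemma coord_projEr D m (M : 'M[F]_(m, n)) i j :
  (M *m coord_proj D) i j = if j \in D then M i j else 0.
Proof. by rewrite mul_mx_diag !mxE; case: ifP; rewrite ?mulr1 ?mulr0. Qed.

Lemma coord_projM D D' : coord_proj D *m coord_proj D' = coord_proj (D :&: D').
Proof.
by rewrite mulmx_diag; congr diag_mx; apply/rowP => i; rewrite !mxE inE -natrM mulnb.
Qed.

Lemma coord_proj_tr D : (coord_proj D)^T = coord_proj D.
Proof. exact: tr_diag_mx. Qed.

End CoordProj.

Lemma rank_coord_proj (F : fieldType) (n : nat) (D : {set 'I_n}) :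
  (\rank (coord_proj F D) <= #|D|)%N.
Proof.
have -> : coord_proj F D =
   (\matrix_(i < n, j < #|D|) (i == enum_val j)%:R) *m
   (\matrix_(j < #|D|, l < n) (l == enum_val j)%:R).
  apply/matrixP => i j; rewrite -[coord_proj F D]mulmx1.
  rewrite coord_projE !mxE; case: ifPn => iD.
    rewrite (bigD1 (enum_rank_in iD i)) //= !mxE enum_rankK_in // eqxx mul1r.
    rewrite big1 ?addr0 1?eq_sym //.
    move=> l li; rewrite !mxE; case: eqP => [e|]; last by rewrite mul0r.
    by case/eqP: li; apply: enum_val_inj; rewrite enum_rankK_in.
  rewrite big1 // => l _; rewrite !mxE; case: eqP => [e|]; last by rewrite mul0r.
  by rewrite e enum_valP in iD.
exact: mulmx_max_rank.
Qed.

(** * Hilbert-Schmidt norms and orthogonal projections *)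

Section SqNorm.
Variable C : numClosedFieldType.

Lemma trmxCM m n p (A : 'M[C]_(m, n)) (B : 'M[C]_(n, p)) :
  (A *m B)^t* = B^t* *m A^t*.
Proof. by rewrite trmx_mul map_mxM. Qed.

Lemma trmxC1 n : (1%:M : 'M[C]_n)^t* = 1%:M.
Proof. by rewrite trmx1 map_mx1. Qed.

Lemma trmxCD m n (A B : 'M[C]_(m, n)) : (A + B)^t* = A^t* + B^t*.
Proof. by rewrite linearD map_mxD. Qed.

Lemma trmxCB m n (A B : 'M[C]_(m, n)) : (A - B)^t* = A^t* - B^t*.
Proof. by rewrite linearB map_mxB. Qed.

Definition sqnorm m n (X : 'M[C]_(m, n)) : C := \sum_i \sum_j `|X i j| ^+ 2.

Lemma sqnormE m n (X : 'M[C]_(m, n)) : sqnorm X = \tr (X^t* *m X).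
Proof.
rewrite /sqnorm exchange_big /=; apply: eq_bigr => j _; rewrite !mxE.
by apply: eq_bigr => i _; rewrite !mxE normCKC.
Qed.

Lemma sqnorm_ge0 m n (X : 'M[C]_(m, n)) : 0 <= sqnorm X.
Proof. by apply: sumr_ge0 => i _; apply: sumr_ge0 => j _; rewrite exprn_ge0. Qed.

Lemma sqnormC m n (X : 'M[C]_(m, n)) : sqnorm (X^t*) = sqnorm X.
Proof. by rewrite !sqnormE trmxCK mxtrace_mulC. Qed.

Lemma sqnorm_isometry m n p (V : 'M[C]_(m, n)) (X : 'M[C]_(n, p)) :
  V^t* *m V = 1%:M -> sqnorm (V *m X) = sqnorm X.
Proof. by move=> VV; rewrite !sqnormE trmxCM -mulmxA (mulmxA (V^t*)) VV mul1mx. Qed.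

Lemma sqnorm_projection n p (P : 'M[C]_n) (X : 'M[C]_(n, p)) :
  P^t* = P -> P *m P = P -> sqnorm X = sqnorm (P *m X) + sqnorm ((1%:M - P) *m X).
Proof.
move=> Ph PP.
have PP' : (1%:M - P) *m (1%:M - P) = 1%:M - P.
  by rewrite mulmxBr mulmx1 mulmxBl mul1mx PP subrr subr0.
rewrite !sqnormE !trmxCM trmxCB trmxC1 Ph -!mulmxA !(mulmxA P) PP.
by rewrite (mulmxA (1%:M - P)) PP' -raddfD /= -mulmxDr -mulmxDl addrC subrK mul1mx.
Qed.

Lemma sqnorm_projection_le n p (P : 'M[C]_n) (X : 'M[C]_(n, p)) :
  P^t* = P -> P *m P = P -> sqnorm (P *m X) <= sqnorm X.
Proof. by move=> Ph PP; rewrite (sqnorm_projection X Ph PP) lerDl sqnorm_ge0. Qed.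

(** The isometry [B^t*] turns [B *m X] into the image of [X] under the orthogonal projection
    [B^t* *m B]. *)
Lemma sqnorm_coisometry_le m n p (B : 'M[C]_(m, n)) (X : 'M[C]_(n, p)) :
  B *m B^t* = 1%:M -> sqnorm (B *m X) <= sqnorm X.
Proof.
move=> BB; rewrite -(@sqnorm_isometry _ _ _ (B^t*)) ?trmxCK // mulmxA.
by apply: sqnorm_projection_le; rewrite ?trmxCM ?trmxCK // mulmxA -(mulmxA _ B) BB mulmx1.
Qed.

Lemma coord_proj_herm n (D : {set 'I_n}) : (coord_proj C D)^t* = coord_proj C D.
Proof.
by rewrite coord_proj_tr; apply/matrixP => i j; rewrite !mxE rmorphMn /= rmorph_nat.
Qed.

Lemma coord_proj_idem n (D : {set 'I_n}) :
  coord_proj C D *m coord_proj C D = coord_proj C D.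
Proof. by rewrite coord_projM setIid. Qed.

Lemma sqnorm_coord_proj n p (D : {set 'I_n}) (X : 'M[C]_(n, p)) :
  sqnorm (coord_proj C D *m X) = \sum_(i in D) \sum_j `|X i j| ^+ 2.
Proof.
rewrite [RHS]big_mkcond; apply: eq_bigr => i _.
under eq_bigr => j _ do rewrite coord_projE.
by case: ifP => // _; rewrite big1 // => j _; rewrite normr0 expr0n.
Qed.

Lemma sqnorm_frame n k (X : 'M[C]_(n, k)) : X^t* *m X = 1%:M -> sqnorm X = k%:R.
Proof. by move=> XX; rewrite sqnormE XX mxtrace1. Qed.

(** Gram-Schmidt on the row space of [M^t*]. The last clause passes to [B] every identity
    [M^t* *m P = M^t*]; [m] is quantified because the size that arises is the rank of [M^t*], only
    provably equal to that of [M]. *)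
Lemma column_space_onb n p (M : 'M[C]_(n, p)) :
  exists m (B : 'M[C]_(m, n)),
    [/\ m = \rank M, B *m B^t* = 1%:M, B^t* *m B *m M = M &
        exists Z : 'M[C]_(m, p), B = Z *m M^t*].
Proof.
pose B := schmidt (row_base (M^t*)).
have BB : B *m B^t* = 1%:M.
  by apply/unitarymxP/schmidt_unitarymx; rewrite rank_leq_col.
have eqB : (B :=: M^t*)%MS.
  by apply: eqmx_trans (eq_row_base _); apply: eqmx_schmidt_free; apply: row_base_free.
exists (\rank (M^t*)), B; split => //.
- by rewrite mxrank_map mxrank_tr.
- have /submxP[Z MZ] : (M^t* <= B)%MS by rewrite eqB.
  have ME : M = B^t* *m Z^t* by rewrite -trmxCM -MZ trmxCK.
  by rewrite [X in _ *m X = _]ME [RHS]ME mulmxA -(mulmxA _ B) BB mulmx1.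
- by apply/submxP; rewrite eqB.
Qed.

(* [B] is an orthonormal basis of the column space of the [D, D'] block of [T];
   off that space, [T] maps into the coordinates in [D] only from outside [D']. *)
Lemma sqnorm_two_coord_projs n k (T : 'M[C]_n) (X : 'M[C]_(n, k)) (D D' : {set 'I_n}) :
  T^t* *m T = 1%:M -> X^t* *m X = 1%:M ->
  sqnorm (coord_proj C D *m (T *m X)) + sqnorm (coord_proj C D' *m X) <=
  k%:R + (\rank (coord_proj C D *m T *m coord_proj C D'))%:R.
Proof.
move=> TT XX; set M := _ *m T *m _; set P := coord_proj C D; set P' := coord_proj C D'.
have [m [B [mM BB BM [Z BE]]]] := column_space_onb M.
have BP : B *m P = B.
  by rewrite BE /M -mulmxA !trmxCM !coord_proj_herm -!mulmxA coord_proj_idem.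
have Qh : (B^t* *m B)^t* = B^t* *m B by rewrite trmxCM trmxCK.
have QQ : B^t* *m B *m (B^t* *m B) = B^t* *m B by rewrite mulmxA -(mulmxA _ B) BB mulmx1.
rewrite (sqnorm_projection _ Qh QQ) (mulmxA _ P) -(mulmxA _ B) BP -mulmxA.
rewrite (@sqnorm_isometry _ _ _ (B^t*)) ?trmxCK //.
(* The frame [T *m X] has a coisometry as adjoint, so the adjoint of [B *m (T *m X)] is no larger
   than [B^t*], whose squared norm is the rank. *)
have le1 : sqnorm (B *m (T *m X)) <= (\rank M)%:R.
  rewrite -sqnormC trmxCM; apply: le_trans (sqnorm_coisometry_le _ _) _.
    by rewrite trmxCK trmxCM -mulmxA (mulmxA (T^t*)) TT mul1mx XX.
  by rewrite sqnormE trmxCK BB mxtrace1 mM.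
have le2 : sqnorm ((1%:M - B^t* *m B) *m (P *m (T *m X))) <= sqnorm ((1%:M - P') *m X).
  have -> : (1%:M - B^t* *m B) *m (P *m (T *m X)) =
            (1%:M - B^t* *m B) *m (P *m (T *m ((1%:M - P') *m X))).
    rewrite (mulmxBl _ P' X) mul1mx !mulmxBr; set Y := (X in _ = _ - X).
    rewrite [Y](_ : _ = 0) ?subr0 //.
    by rewrite /Y (mulmxA T) (mulmxA P) (mulmxA P) -/M mulmxA mulmxBl mul1mx BM subrr mul0mx.
  apply: le_trans (sqnorm_projection_le _ _ _) _.
  - by rewrite trmxCB trmxC1 Qh.
  - by rewrite mulmxBr mulmx1 mulmxBl mul1mx QQ subrr subr0.
  apply: le_trans (sqnorm_projection_le _ _ _) _; [exact: coord_proj_herm|exact: coord_proj_idem|].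
  by rewrite sqnorm_isometry.
(* Splitting [k = sqnorm X] along [P'] cancels the term of [D']. *)
rewrite -(sqnorm_frame XX) (sqnorm_projection X (coord_proj_herm D') (coord_proj_idem D')).
rewrite -/P' [leLHS]addrC -addrA lerD2l [leRHS]addrC; exact: lerD.
Qed.

End SqNorm.

(** * Decreasing rearrangements and spectral decompositions *)

Section Decr.
Variables (R : realType) (N : nat).
Implicit Types x y : 'rV[R]_N.

Lemma decr_perm x : exists s : 'S_N, forall i, decr x 0 i = x 0 (s i).
Proof.
pose T := [tuple x 0 i | i < N].
have /tuple_permP[s sE] : perm_eq (sort >=%R T) T by rewrite perm_sort.
exists s => i; rewrite mxE.
have -> : [seq x 0 j | j <- enum 'I_N] = T by [].
by rewrite sE -tnth_nth !tnth_mktuple.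
Qed.

Lemma decr_anti x (i j : 'I_N) : (i <= j)%N -> decr x 0 j <= decr x 0 i.
Proof.
move=> ij; rewrite !mxE.
have sz : size (sort >=%R [seq x 0 j | j <- enum 'I_N]) = N.
  by rewrite size_sort size_map size_enum_ord.
apply: (@sorted_leq_nth _ >=%R); rewrite ?inE ?sz //.
- exact: rev_trans le_trans.
- exact: lexx.
- by apply: sort_sorted => a b; exact: le_total.
Qed.

Lemma decr_eq x y :
  perm_eq [seq x 0 j | j <- enum 'I_N] [seq y 0 j | j <- enum 'I_N] -> decr x = decr y.
Proof.
move=> xy; apply/rowP => i; rewrite !mxE; congr (_`_i); apply/perm_sortP => //.
- by move=> a b; exact: le_total.
- exact: rev_trans le_trans.
- by move=> a b; rewrite andbC => /le_anti.
Qed.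

Lemma decr_id x : (forall i j : 'I_N, (i <= j)%N -> x 0 j <= x 0 i) -> decr x = x.
Proof.
move=> xanti; apply/rowP => i; rewrite mxE sorted_sort.
- by rewrite (nth_map i) ?size_enum_ord // nth_ord_enum.
- exact: rev_trans le_trans.
rewrite (sorted_pairwise (rev_trans le_trans)) pairwise_map.
have : pairwise ltn (map val (enum 'I_N)).
  by rewrite val_enum_ord -(sorted_pairwise ltn_trans) iota_ltn_sorted.
by rewrite pairwise_map; apply: sub_pairwise => a b /ltnW /xanti.
Qed.

Lemma decrK x : decr (decr x) = decr x.
Proof. by apply: decr_id => i j; exact: decr_anti. Qed.

End Decr.

Lemma char_poly_similar (F : fieldType) (n : nat) (P D : 'M[F]_n) :
  P \in unitmx -> char_poly (invmx P *m D *m P) = char_poly D.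
Proof.
move=> Pu; rewrite /char_poly.
have -> : char_poly_mx (invmx P *m D *m P) =
    map_mx polyC (invmx P) *m char_poly_mx D *m map_mx polyC P.
  rewrite /char_poly_mx mulmxBr mulmxBl !map_mxM; congr (_ - _).
  by rewrite scalar_mxC -mulmxA -map_mxM mulVmx // map_mx1 mulmx1.
by rewrite !det_mulmx mulrAC -det_mulmx -map_mxM mulVmx // map_mx1 det1 mul1r.
Qed.


Section Spectral.
Variables (R : realType) (n : nat).
Local Notation C := R[i].

Lemma eigvals_perm (D : 'rV[C]_n) (P : 'M[C]_n) :
  P \in unitmx ->
  perm_eq (eigvals (invmx P *m diag_mx D *m P)) [seq D 0 i | i <- enum 'I_n].
Proof.
move=> Pu; rewrite /eigvals; case: closed_field_poly_normal => s /=.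
rewrite (monicP (char_poly_monic _)) scale1r char_poly_similar //.
rewrite char_poly_trig ?diag_mx_is_trig // => e; apply: prod_XsubC_eq.
rewrite -e big_map big_enum /=; apply: eq_bigr => i _.
by rewrite mxE eqxx mulr1n.
Qed.

(** The spectral theorem with the eigenvalues permuted so that their images under [f] decrease:
    [f = id] yields [lambda_vec], and the square root yields [sigma_vec] through the Gram matrix. *)
Lemma hermitian_diagonalization (f : R -> R) (H : 'M[C]_n) :
  H \is hermsymmx ->
  exists (U : 'M[C]_n) (a : 'rV[R]_n),
    [/\ U \is unitarymx, H = U^t* *m diag_mx (cmx a) *m U &
        forall i, decr (\row_(i < n) f (complex.Re (eigvals H)`_i)) 0 i = f (a 0 i)].
Proof.
move=> Hh; have /orthomx_spectralP HE := hermitian_normalmx Hh.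
have Dr := hermitian_spectral_diag_real Hh.
have Pu := spectral_unitarymx H; have Pi := spectral_unit H.
set P := spectralmx H in HE Pu Pi; set D := spectral_diag H in HE Dr.
have DE i : (complex.Re (D 0 i))%:C%C = D 0 i by rewrite RRe_real // (mxOverP Dr).
have [s sE] := decr_perm (\row_(i < n) f (complex.Re (D 0 i))).
exists (row_perm s P), (\row_i complex.Re (D 0 (s i))); split.
- apply/unitarymxP; rewrite row_permE trmxCM.
  rewrite mulmxA -(mulmxA _ P) (unitarymxP Pu) mulmx1.
  rewrite tr_perm_mx map_perm_mx -perm_mxM.
  by rewrite mulgV perm_mx1.
- rewrite {1}HE invmx_unitary //; apply/matrixP => i j.
  rewrite !mul_mx_diag [LHS]mxE [RHS]mxE (reindex_inj (@perm_inj _ s)) /=.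
  by apply: eq_bigr => k _; rewrite !mxE DE.
move=> i; rewrite [RHS](_ : _ = (\row_(i < n) f (complex.Re (D 0 i))) 0 (s i)); last first.
  by rewrite !mxE.
rewrite -sE; congr (fun_of_matrix _ 0 i); apply: decr_eq.
have -> : [seq (\row_(i < n) f (complex.Re (eigvals H)`_i)) 0 j | j <- enum 'I_n] =
    [seq f (complex.Re z) | z <- eigvals H].
  rewrite -[in RHS](mkseq_nth 0 (eigvals H)) /mkseq size_eigvals.
  rewrite -val_enum_ord -!(map_comp _ _ (enum _)).
  by apply: eq_map => k; rewrite mxE.
have -> : [seq (\row_(i < n) f (complex.Re (D 0 i))) 0 j | j <- enum 'I_n] =
    [seq f (complex.Re z) | z <- [seq D 0 i | i <- enum 'I_n]].
  by rewrite -[RHS]map_comp; apply: eq_map => k; rewrite mxE.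
by apply: perm_map; rewrite HE eigvals_perm.
Qed.

Lemma decr_sigma_vec (M : 'M[C]_n) : decr (sigma_vec M) = sigma_vec M.
Proof. exact: decrK. Qed.

Lemma decr_lambda_vec (M : 'M[C]_n) : decr (lambda_vec M) = lambda_vec M.
Proof. exact: decrK. Qed.

Lemma sigma_vec_anti (M : 'M[C]_n) (i j : 'I_n) :
  (i <= j)%N -> sigma_vec M 0 j <= sigma_vec M 0 i.
Proof. exact: decr_anti. Qed.

Lemma lambda_vec_anti (M : 'M[C]_n) (i j : 'I_n) :
  (i <= j)%N -> lambda_vec M 0 j <= lambda_vec M 0 i.
Proof. exact: decr_anti. Qed.

Lemma psd_diag_ge0 (H U : 'M[C]_n) (a : 'rV[R]_n) i :
  psd H -> U \is unitarymx -> H = U^t* *m diag_mx (cmx a) *m U -> 0 <= a 0 i.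
Proof.
move=> [_ Hp] Uu HE; rewrite -lecR.
(* The quadratic form is evaluated at the eigenvector belonging to [a 0 i]. *)
have := Hp ((row i U)^t*); rewrite trmxCK.
have -> : row i U *m H *m (row i U)^t* = row i (diag_mx (cmx a)) *m (delta_mx 0 i)^T.
  rewrite HE !rowE trmxCM !mulmxA -(mulmxA _ U) (unitarymxP Uu) mulmx1.
  rewrite -!mulmxA (mulmxA U) (unitarymxP Uu) mul1mx.
  by congr (_ *m (_ *m _)); apply/matrixP => k l; rewrite !mxE rmorph_nat.
by rewrite trmx_delta -colE !mxE eqxx mulr1n.
Qed.

Lemma hermsymmxE (H : 'M[C]_n) : H \is hermsymmx <-> H^t* = H.
Proof.
by split=> [/is_hermitianmxP|h]; [|apply/is_hermitianmxP]; rewrite expr0 scale1r.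
Qed.

Lemma hermsymmxD (H K : 'M[C]_n) :
  H \is hermsymmx -> K \is hermsymmx -> H + K \is hermsymmx.
Proof. by move=> /hermsymmxE hH /hermsymmxE hK; apply/hermsymmxE; rewrite trmxCD hH hK. Qed.

Lemma psd_gram (m : nat) (M : 'M[C]_(m, n)) : psd (M^t* *m M).
Proof.
split; first by apply/hermsymmxE; rewrite trmxCM trmxCK.
move=> v; have -> : v^t* *m (M^t* *m M) *m v = (M *m v)^t* *m (M *m v).
  by rewrite trmxCM !mulmxA.
rewrite mxE sumr_ge0 // => k _; rewrite !mxE -normCKC exprn_ge0 //.
Qed.

Lemma hermitian_spectral (H : 'M[C]_n) : H \is hermsymmx ->
  exists2 U : 'M[C]_n, U \is unitarymx & H = U^t* *m diag_mx (cmx (lambda_vec H)) *m U.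
Proof.
move=> Hh; have [U [a [Uu HE aE]]] := hermitian_diagonalization id Hh.
have -> : lambda_vec H = a by apply/rowP => i; exact: aE.
by exists U.
Qed.

Lemma lambda_vec_ge0 (H : 'M[C]_n) i : psd H -> 0 <= lambda_vec H 0 i.
Proof. by move=> Hp; have [U Uu HE] := hermitian_spectral Hp.1; exact: psd_diag_ge0 Hp Uu HE. Qed.

Lemma sigma_vec_ge0 (M : 'M[C]_n) i : 0 <= sigma_vec M 0 i.
Proof.
rewrite /sigma_vec; set x := (X in decr X).
by have [s ->] := decr_perm x; rewrite mxE sqrtr_ge0.
Qed.

(* Gram-Schmidt writes [B] as [L U] with [L] lower triangular; the rows of [L]
   are orthogonal, and the zero rows come last, so [L] is diagonal. *)
Lemma orthogonal_rows_normalize (B : 'M[C]_n) (a : 'rV[R]_n) :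
  (forall i, 0 <= a 0 i) -> (forall i j : 'I_n, (i <= j)%N -> a 0 j <= a 0 i) ->
  B *m B^t* = diag_mx (cmx (\row_i (a 0 i ^+ 2))) ->
  exists2 U : 'M[C]_n, U \is unitarymx & B = diag_mx (cmx a) *m U.
Proof.
move=> a0 anti BB; pose U := schmidt B.
have Uu : U \is unitarymx by apply: schmidt_unitarymx.
exists U => //; pose L := B *m U^t*.
have BL : B = L *m U by rewrite /L -mulmxA -(invmx_unitary Uu) mulVmx ?mulmx1 ?unitarymx_unit.
have LL i j : \sum_k L i k * (L j k)^* = (a 0 i)%:C%C ^+ 2 *+ (i == j).
  transitivity ((L *m L^t*) i j); first by rewrite mxE; apply: eq_bigr => k _; rewrite !mxE.
  rewrite /L trmxCM trmxCK mulmxA -(mulmxA _ (U^t*)) -(invmx_unitary Uu) mulVmx ?unitarymx_unit //.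
  by rewrite mulmx1 BB !mxE rmorphXn.
have Lt (i j : 'I_n) : (i < j)%N -> L i j = 0.
  move=> ij; have /sub_sumsmxP[u ru] := row_schmidt_sub B i.
  have -> : L i j = (row i B *m (row j U)^t*) 0 0.
    by rewrite !mxE; apply: eq_bigr => k _; rewrite !mxE.
  rewrite ru mulmx_suml summxE big1 // => k ki.
  have /submxP[w ->] : (u k *m <<row k (schmidt B)>> <= row k U)%MS.
    by rewrite mulmx_sub // genmxE.
  have /matrixP/(_ k j) := unitarymxP Uu; rewrite [RHS]mxE.
  have -> : (k == j) = false by apply: contraTF ki => /eqP ->; rewrite -ltnNge.
  rewrite mulr0n => e; rewrite -mulmxA mxE big_ord1.
  have -> : (row k U *m (row j U)^t*) 0 0 = (U *m U^t*) k j.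
    by rewrite [LHS]mxE [RHS]mxE; apply: eq_bigr => l _; rewrite !mxE.
  by rewrite e mulr0.
have Ld i : 0 <= L i i.
  have := form1_row_schmidt B i; rewrite dotmxE; congr (0 <= _).
  by rewrite !mxE; apply: eq_bigr => k _; rewrite !mxE.
(* Induction on columns: row [j] of [L] is reduced to its diagonal entry, which must be [a 0 j].
   Orthogonality to row [j] clears column [j] below it, unless [a 0 j = 0]; then [a 0 i = 0] by
   monotonicity and the whole row [i] vanishes. *)
have main m : forall j : 'I_n, (j < m)%N ->
    L j j = (a 0 j)%:C%C /\ forall i : 'I_n, (j < i)%N -> L i j = 0.
  elim: m => // m IH j jm.
  have Lj k : k != j -> L j k = 0.
    by case: (ltngtP k j) => [kj _|jk _|/val_inj -> /eqP//]; [apply: (IH k _).2 | apply: Lt];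
       rewrite // (leq_trans kj).
  have Ljj : L j j = (a 0 j)%:C%C.
    have := LL j j; rewrite (bigD1 j) //= big1 => [|k /Lj ->]; last by rewrite mul0r.
    rewrite addr0 eqxx mulr1n -normCK ger0_norm // => /eqP.
    by rewrite eqrXn2 ?ler0c // => /eqP.
  split=> // i ji; have := LL i j; rewrite (bigD1 j) //= big1 => [|k /Lj ->]; last first.
    by rewrite conjC0 mulr0.
  have -> : (i == j) = false by apply: contraTF ji => /eqP ->; rewrite ltnn.
  rewrite addr0 mulr0n => /eqP; rewrite mulf_eq0 conjC_eq0 Ljj => /orP[/eqP //|/eqP].
  move/(congr1 (@complex.Re _)) => /= aj0.
  have ai0 : a 0 i = 0.
    by apply/eqP; rewrite eq_le a0 andbT -[X in _ <= X]aj0 anti // ltnW.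
  have /eqP := LL i i; rewrite ai0 expr0n mul0rn.
  rewrite psumr_eq0 => [/allP/(_ j)|k _]; last by rewrite -normCK exprn_ge0.
  by rewrite mem_index_enum => /(_ isT); rewrite -normCK sqrf_eq0 normr_eq0 => /eqP.
rewrite [LHS]BL; congr (_ *m _); apply/matrixP => i j; rewrite [RHS]mxE [X in X *+ _]mxE.
have [->|ij] := eqVneq i j; first by rewrite mulr1n (main n j _).1.
rewrite mulr0n; case: (ltngtP i j) => [/Lt//|ji|/val_inj e]; last by rewrite e eqxx in ij.
exact: (main n j _).2.
Qed.

(** If [V] diagonalizes [M^t* *m M], the rows of [V *m M^t*] are orthogonal with the singular values
    as lengths; normalizing them gives the other unitary factor. *)
Lemma singular_value_decomposition (M : 'M[C]_n) :
  exists U V : 'M[C]_n, [/\ U \is unitarymx, V \is unitarymx &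
    M = U^t* *m diag_mx (cmx (sigma_vec M)) *m V].
Proof.
have gp := psd_gram M.
have [V [a [Vu HE aE]]] := hermitian_diagonalization (@Num.sqrt R) gp.1.
have [|i j ij||Q Qu QE] := @orthogonal_rows_normalize (V *m M^t*) (sigma_vec M).
- by move=> i; apply: sigma_vec_ge0.
- exact: sigma_vec_anti.
- rewrite trmxCM trmxCK mulmxA -(mulmxA V) HE !mulmxA (unitarymxP Vu) mul1mx.
  rewrite -mulmxA (unitarymxP Vu) mulmx1; congr (diag_mx (cmx _)); apply/rowP => i.
  by rewrite mxE aE sqr_sqrtr // (psd_diag_ge0 i gp Vu HE).
exists Q, V; split; [exact: Qu|exact: Vu|].
have DC : (diag_mx (cmx (sigma_vec M)))^t* = diag_mx (cmx (sigma_vec M)).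
  move: (sigma_vec M) => x; rewrite tr_diag_mx map_diag_mx; congr diag_mx.
  by apply/rowP => i; rewrite !mxE; exact: conjc_real.
rewrite -[X in _ *m X *m _]DC -trmxCM -QE trmxCM trmxCK -mulmxA -(invmx_unitary Vu).
by rewrite (mulVmx (unitarymx_unit Vu)) mulmx1.
Qed.

End Spectral.

(** * Frames attaining the sum of the largest entries *)

Section TopSums.
Variables (R : realType) (N : nat).
Implicit Types z : 'rV[R]_N.

Lemma sum_decr z : \sum_i decr z 0 i = \sum_i z 0 i.
Proof.
have [s sE] := decr_perm z; rewrite [RHS](reindex_inj (@perm_inj _ s)).
by apply: eq_bigr => i _; rewrite sE.
Qed.

Lemma top_set z k : (1 <= k <= N)%N ->
  exists (F : {set 'I_N}) (j : 'I_N),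
    [/\ #|F| = k, \sum_(i < N | (i < k)%N) decr z 0 i = \sum_(i in F) z 0 i,
        forall i, i \in F -> z 0 j <= z 0 i & forall i, i \notin F -> z 0 i <= z 0 j].
Proof.
case/andP => k1 kN; have [s sE] := decr_perm z.
have kN' : (k.-1 < N)%N by rewrite prednK.
(* The threshold is the [k]-th largest entry, at position [k.-1] counted from 0. *)
exists [set s i | i : 'I_N & (i < k)%N], (s (Ordinal kN')); split.
- rewrite card_imset; last exact: perm_inj.
  have wI : injective (widen_ord kN) by move=> a b /(congr1 val) /= /val_inj.
  rewrite -[RHS]card_ord -(card_imset _ wI).
  apply: eq_card => i; rewrite inE; apply/idP/imsetP => [ik|[l _ ->]]; last by rewrite /= ltn_ord.
  by exists (Ordinal ik) => //; apply: val_inj.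
- rewrite big_imset /=; last by move=> i j _ _; exact: perm_inj.
  by apply: eq_big => [i|i _]; rewrite ?inE ?sE.
- move=> _ /imsetP[i ik ->]; rewrite -!sE; apply: decr_anti.
  by rewrite inE in ik; rewrite /= -ltnS prednK.
move=> i iF; rewrite -(permKV s i) -!sE; apply: decr_anti => /=.
rewrite leqNgt; apply: contra iF => ik; apply/imsetP; exists (s^-1 i)%g; rewrite ?permKV //.
by rewrite inE (leq_trans ik) // leq_pred.
Qed.

End TopSums.

(** * Row weights, trace estimates and leading frames *)

Section RowNorm.
Variable R : realType.
Local Notation C := R[i].

(** These are the weights [p_I] and [q_I], taken in [R] because the level-set estimate is over an
    ordered field. *)
Definition row_sqnorm m n (X : 'M[C]_(m, n)) i : R :=
  complex.Re (\sum_j `|X i j| ^+ 2).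

Lemma row_sqnormE m n (X : 'M[C]_(m, n)) i :
  (row_sqnorm X i)%:C%C = \sum_j `|X i j| ^+ 2.
Proof. by rewrite RRe_real // ger0_real // sumr_ge0 // => j _; rewrite exprn_ge0. Qed.

Lemma sum_row_sqnorm m n (X : 'M[C]_(m, n)) (D : {set 'I_m}) :
  (\sum_(i in D) row_sqnorm X i)%:C%C = sqnorm (coord_proj C D *m X).
Proof.
by rewrite sqnorm_coord_proj rmorph_sum /=; apply: eq_bigr => i _; rewrite row_sqnormE.
Qed.

Lemma sum_row_sqnorm_le m n (X Y : 'M[C]_(m, n)) (D D' : {set 'I_m}) (k l : nat) :
  sqnorm (coord_proj C D *m X) + sqnorm (coord_proj C D' *m Y) <= k%:R + l%:R ->
  \sum_(i in D) row_sqnorm X i + \sum_(i in D') row_sqnorm Y i <= k%:R + l%:R.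
Proof.
rewrite -!sum_row_sqnorm -!natrD -(rmorph_nat (real_complex R)) -rmorphD lecR.
by rewrite natrD.
Qed.

(** The adjoint of a frame is a contraction, here applied to a standard unit vector. *)
Lemma row_sqnorm_le1 m n (X : 'M[C]_(m, n)) i :
  X^t* *m X = 1%:M -> row_sqnorm X i <= 1.
Proof.
move=> XX; rewrite -lecR row_sqnormE.
have -> : \sum_j `|X i j| ^+ 2 = sqnorm (delta_mx 0 i *m X : 'rV[C]_n).
  by rewrite /sqnorm big_ord1 -rowE; apply: eq_bigr => j _; rewrite mxE.
rewrite -sqnormC trmxCM; apply: le_trans (sqnorm_coisometry_le _ _) _; first by rewrite trmxCK.
rewrite sqnormC /sqnorm big_ord1 (bigD1 i) //= mxE !eqxx normr1 expr1n big1 ?addr0 //.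
by move=> j /negbTE ji; rewrite mxE ji andbF normr0 expr0n.
Qed.

Lemma re_mul_real (a : R) (z : C) : complex.Re (a%:C%C * z) = a * complex.Re z.
Proof. by case: z => b c /=; rewrite mul0r subr0. Qed.

Lemma re_dot_le (y x : C) :
  complex.Re (y^* * x) <= 2^-1 * (complex.Re (`|y| ^+ 2) + complex.Re (`|x| ^+ 2)).
Proof.
rewrite !normCK; case: y => a b; case: x => c e /=.
have : 0 <= (a - c) ^+ 2 + (b - e) ^+ 2 by rewrite addr_ge0 ?sqr_ge0.
nra.
Qed.

Lemma re_trace_diag_le m n (a : 'rV[R]_m) (Y X : 'M[C]_(m, n)) :
  (forall i, 0 <= a 0 i) ->
  complex.Re (\tr (Y^t* *m diag_mx (cmx a) *m X)) <=
  2^-1 * (\sum_i a 0 i * row_sqnorm Y i + \sum_i a 0 i * row_sqnorm X i).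
Proof.
move=> a0.
have -> : \tr (Y^t* *m diag_mx (cmx a) *m X) =
    \sum_i (a 0 i)%:C%C * \sum_j (Y i j)^* * X i j.
  rewrite mxtrace_mulC mul_mx_diag; apply: eq_bigr => i _; rewrite mxE mulr_sumr.
  by apply: eq_bigr => j _; rewrite !mxE; ring.
rewrite -big_split mulr_sumr raddf_sum /=; apply: ler_sum => i _.
rewrite -mulrDr mulrCA re_mul_real; apply: ler_wpM2l => //.
rewrite /row_sqnorm !raddf_sum -big_split mulr_sumr; apply: ler_sum => j _ /=.
exact: re_dot_le.
Qed.

Lemma re_trace_conj_le m n k (a : 'rV[R]_m) (P Q : 'M[C]_(m, n)) (Y X : 'M[C]_(n, k)) :
  (forall i, 0 <= a 0 i) ->
  complex.Re (\tr (Y^t* *m (P^t* *m diag_mx (cmx a) *m Q) *m X)) <=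
  2^-1 * (\sum_i a 0 i * row_sqnorm (P *m Y) i + \sum_i a 0 i * row_sqnorm (Q *m X) i).
Proof.
have -> : Y^t* *m (P^t* *m diag_mx (cmx a) *m Q) *m X =
    (P *m Y)^t* *m diag_mx (cmx a) *m (Q *m X) by rewrite trmxCM !mulmxA.
exact: re_trace_diag_le.
Qed.

Lemma re_trace_add n k (P Q : 'M[C]_n) (Y X : 'M[C]_(n, k)) :
  complex.Re (\tr (Y^t* *m (P + Q) *m X)) =
  complex.Re (\tr (Y^t* *m P *m X)) + complex.Re (\tr (Y^t* *m Q *m X)).
Proof. by rewrite mulmxDr mulmxDl mxtraceD; move: (\tr _) (\tr _) => [? ?] [? ?]. Qed.

Lemma half_sums_le (u v u' v' z : R) :
  u + u' <= z -> v + v' <= z -> 2^-1 * (u + v) + 2^-1 * (u' + v') <= z.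
Proof. lra. Qed.

End RowNorm.

(** The frames are the first [k] columns of [V^t*] and [U^t*], between which [M] is diagonal. This
    turns the left side of the majorization into a trace. *)
Lemma top_frames (R : realType) (N k : nat) (x : 'rV[R]_N) (M U V : 'M[R[i]]_N) :
  U \is unitarymx -> V \is unitarymx -> (1 <= k <= N)%N ->
  M = U^t* *m diag_mx (cmx x) *m V ->
  exists X Y : 'M[R[i]]_(N, k),
    [/\ X^t* *m X = 1%:M, Y^t* *m Y = 1%:M &
        complex.Re (\tr (Y^t* *m M *m X)) = \sum_(i < N | (i < k)%N) x 0 i].
Proof.
move=> Uu Vu /andP[_ kN] ->; pose J := lead_incl (R[i]) k N.
have JC : J^T^t* = J.
  by apply/matrixP => i j; rewrite !mxE rmorph_nat.
have frame (W : 'M[R[i]]_N) : W \is unitarymx -> (W^t* *m J^T)^t* *m (W^t* *m J^T) = 1%:M.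
  move=> Wu; rewrite trmxCM JC trmxCK mulmxA -(mulmxA J) (unitarymxP Wu) mulmx1.
  exact: lead_inclK.
exists (V^t* *m J^T), (U^t* *m J^T); split; try exact: frame.
rewrite trmxCM JC trmxCK !mulmxA -(mulmxA J) (unitarymxP Uu) mulmx1.
rewrite -!mulmxA (mulmxA V) (unitarymxP Vu) mul1mx !mulmxA.
have -> : \tr (J *m diag_mx (cmx x) *m J^T) = (\sum_(i < N | (i < k)%N) x 0 i)%:C%C.
  rewrite mxtrace_mulC mulmxA mul_mx_diag rmorph_sum [RHS]big_mkcond.
  apply: eq_bigr => i _; rewrite mxE [cmx x _ _]mxE mxE.
  case: ifPn => ik; last first.
    rewrite big1 ?mul0r // => j _; rewrite !mxE [_ == _](_ : _ = false) ?mul0r //.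
    by apply: contraNF ik => /eqP /= <-; exact: ltn_ord.
  rewrite (bigD1 (Ordinal ik)) //= !mxE eqxx mul1r big1 ?addr0 ?mul1r // => j ji.
  rewrite !mxE [_ == _](_ : _ = false) ?mul0r //.
  by apply: contraNF ji => /eqP e; apply/eqP/val_inj.
by [].
Qed.

(** * Exterior and symmetric powers *)

Section TensorPow.
Variables (R : realType) (d r : nat).
Local Notation ev i := (enum_val i : multi d r).

Lemma tensor_powM (A B : 'M[R[i]]_d) :
  tensor_pow r (A *m B) = tensor_pow r A *m tensor_pow r B.
Proof.
apply/matrixP => i j; rewrite !mxE.
under eq_bigr => t _ do rewrite mxE.
rewrite bigA_distr_bigA /= (reindex (@enum_val _ (multi d r))) /=; last first.
  by apply: onW_bij; exact: enum_val_bij.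
by apply: eq_bigr => k _; rewrite !mxE big_split.
Qed.

Lemma tensor_pow_diag (a : 'rV[R[i]]_d) :
  tensor_pow r (diag_mx a) = diag_mx (\row_i \prod_(t < r) a 0 (ev i t)).
Proof.
apply/matrixP => i j; rewrite !mxE; have [->|ij] := eqVneq i j.
  by rewrite mulr1n; apply: eq_bigr => t _; rewrite !mxE eqxx mulr1n.
rewrite mulr0n; suff [t tij] : exists t, ev i t != ev j t.
  by rewrite (bigD1 t) //= mxE (negbTE tij) mulr0n mul0r.
apply/existsP; rewrite -negb_forall; apply: contra ij => /forallP h.
by apply/eqP/enum_val_inj/ffunP => t; apply/eqP.
Qed.

Lemma tensor_powC (A : 'M[R[i]]_d) : tensor_pow r (A^t*) = (tensor_pow r A)^t*.
Proof.
by apply/matrixP => i j; rewrite !mxE rmorph_prod; apply: eq_bigr => t _; rewrite !mxE.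
Qed.

(** Polynomial dependence on the shift is what lets a minor that is nonzero at one [e] stay nonzero
    at generic [e]. *)
Lemma tensor_pow_shift (A : 'M[R[i]]_d) :
  exists P : 'M[{poly R[i]}]_#|multi d r|,
    forall e, map_mx (horner_eval e) P = tensor_pow r (A + e%:M).
Proof.
exists (\matrix_(i, j) \prod_(t < r)
  ((A (ev i t) (ev j t))%:P + 'X *+ (ev i t == ev j t))).
move=> e; apply/matrixP => i j; rewrite !mxE /= /horner_eval horner_prod.
by apply: eq_bigr => t _; rewrite !mxE hornerD hornerC hornerMn hornerX.
Qed.

End TensorPow.

(* Pigeonhole: [s] cannot send all of [0, u] below [u]. *)
Lemma nondecr_dominated (d r : nat) (g h : multi d r) (s : 'S_r) :
  g \in nondecr_tuples d r -> h \in nondecr_tuples d r ->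
  (forall u, (h (s u) <= g u)%N) -> forall u, (h u <= g u)%N.
Proof.
rewrite !inE => /'forall_forallP gS /'forall_forallP hS hg u.
have mono (f : multi d r) (a b : 'I_r) :
    (forall s t : 'I_r, (s < t)%N ==> (f s <= f t)%N) -> (a <= b)%N -> (f a <= f b)%N.
  move=> fS; rewrite leq_eqVlt => /orP[/eqP/val_inj -> //|].
  exact: implyP (fS a b).
have /existsP[v /andP[vu uv]] : [exists v : 'I_r, (v <= u)%N && (u <= s v)%N].
  apply: contraT; rewrite negb_exists => /forallP no.
  have sub : s @: [set v : 'I_r | (v <= u)%N] \subset [set v : 'I_r | (v < u)%N].
    apply/subsetP => w /imsetP[v]; rewrite !inE => vu ->.
    by have := no v; rewrite vu /= -ltnNge.
  have := subset_leq_card sub; rewrite card_imset; last exact: perm_inj.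
  have -> : [set v : 'I_r | (v <= u)%N] = u |: [set v : 'I_r | (v < u)%N].
    by apply/setP => v; rewrite !inE leq_eqVlt -val_eqE.
  by rewrite cardsU1 inE ltnn add1n ltnn.
by apply: leq_trans (mono h _ _ hS uv) _; apply: leq_trans (hg v) (mono g _ _ gS vu).
Qed.

(** * Tensor powers restricted to an invariant subspace *)

Section InducedPow.
Variables (R : realType) (d r : nat) (S : {set multi d r}).
Variable W : 'M[R[i]]_(#|multi d r|, #|S|).
Local Notation C := R[i].

(** With [W] the wedge or the symmetric basis this is [ext_pow] or [sym_pow], so both cases are
    treated at once. *)
Definition induced_pow (A : 'M[C]_d) : 'M[C]_#|S| := W^t* *m tensor_pow r A *m W.
Local Notation rho := induced_pow.

Hypothesis S_nondecr : S \subset nondecr_tuples d r.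
Hypothesis W_orthonormal : W^t* *m W = 1%:M.
Hypothesis W_stable : forall A, tensor_pow r A *m W = W *m rho A.
Hypothesis W_supp :
  forall i j, W i j != 0 -> exists s, enum_val i = multi_perm (enum_val j) s.

Lemma induced_powM A B : rho (A *m B) = rho A *m rho B.
Proof. by rewrite {1}/rho tensor_powM -!mulmxA W_stable !mulmxA. Qed.

Lemma induced_powC A : rho (A^t*) = (rho A)^t*.
Proof. by rewrite /rho !trmxCM trmxCK tensor_powC mulmxA. Qed.

(** Each column of [W] is supported on rearrangements of one tuple, where the diagonal entries of
    the tensor power agree; so it is an eigenvector. *)
Lemma induced_pow_diag (a : 'rV[C]_d) :
  rho (diag_mx a) = diag_mx (\row_(j < #|S|) \prod_(t < r) a 0 (enum_val j t)).
Proof.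
rewrite /rho -mulmxA tensor_pow_diag.
set b := (X in diag_mx X *m _); set c := (X in _ = diag_mx X).
have bc i j : W i j != 0 -> b 0 i = c 0 j.
  move=> /W_supp[s e]; rewrite !mxE e [RHS](reindex_inj (@perm_inj _ s)).
  by apply: eq_bigr => t _; rewrite ffunE.
have -> : diag_mx b *m W = W *m diag_mx c.
  rewrite mul_diag_mx mul_mx_diag; apply/matrixP => i j; rewrite [LHS]mxE [RHS]mxE.
  by have [->|/bc ->] := eqVneq (W i j) 0; rewrite ?mulr0 ?mul0r // mulrC.
by rewrite mulmxA W_orthonormal mul1mx.
Qed.

Lemma induced_pow1 : rho 1%:M = 1%:M.
Proof.
have -> : (1%:M : 'M[C]_d) = diag_mx (const_mx 1) by rewrite diag_const_mx.
rewrite induced_pow_diag -diag_const_mx; congr diag_mx; apply/rowP => j.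
by rewrite !mxE big1 // => t _; rewrite mxE.
Qed.

Lemma induced_pow_unitary (U : 'M[C]_d) :
  U \is unitarymx -> (rho U)^t* *m rho U = 1%:M.
Proof.
move=> Uu; rewrite -induced_powC -induced_powM.
by rewrite -(invmx_unitary Uu) mulVmx ?unitarymx_unit // induced_pow1.
Qed.

Definition tuple_le (i j : 'I_#|S|) : bool :=
  [forall t, enum_val i t <= enum_val j t]%N.

(** Small indices carry large singular values, so the upper level sets of [tuple_prod] are of this
    kind. *)
Definition down_set (D : {set 'I_#|S|}) : Prop :=
  forall i j, j \in D -> tuple_le i j -> i \in D.

(** The entry is a combination of products of entries of [A] over rearrangements of the two tuples;
    if it is nonzero, some such product has no zero factor. *)
Lemma induced_pow_supp (A : 'M[C]_d) (i j : 'I_#|S|) :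
  rho A i j != 0 ->
  exists s : 'S_r, forall u, A (enum_val i u) (enum_val j (s u)) != 0.
Proof.
move=> nz.
have /existsP[k /existsP[l /and3P[Wi Akl Wj]]] :
    [exists k, exists l, [&& W k i != 0, tensor_pow r A k l != 0 & W l j != 0]].
  apply: contraT; rewrite negb_exists => /forallP no; case/eqP: nz.
  rewrite mxE big1 // => l _; rewrite mxE mulr_suml big1 // => k _.
  have := no k; rewrite negb_exists => /forallP/(_ l); rewrite !negb_and !negbK.
  by rewrite !mxE; case/or3P => /eqP ->; rewrite ?conjC0 ?mulr0 ?mul0r.
have [s es] := W_supp Wi; have [t et] := W_supp Wj.
exists (s^-1 * t)%g => u; move: Akl; rewrite mxE es et => /prodf_neq0/(_ (s^-1 u)%g isT).
by rewrite !ffunE permKV permM.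
Qed.

Lemma enum_val_nondecr (i : 'I_#|S|) : enum_val i \in nondecr_tuples d r.
Proof. exact: subsetP S_nondecr _ (enum_valP i). Qed.

(** Triangularity compares the tuples along some matching of positions; as both are sorted,
    [nondecr_dominated] makes the comparison positionwise. *)
Lemma induced_pow_trig (L : 'M[C]_d) i j :
  is_trig_mx L -> rho L i j != 0 -> tuple_le j i.
Proof.
move=> /is_trig_mxP Lt /induced_pow_supp[s h]; apply/forallP.
apply: (@nondecr_dominated d r _ _ s); rewrite ?enum_val_nondecr // => u.
by rewrite leqNgt; apply: contra (h u) => lt; rewrite Lt.
Qed.

Lemma induced_pow_trig_tr (U : 'M[C]_d) i j :
  is_trig_mx U^T -> rho U i j != 0 -> tuple_le i j.
Proof.
move=> /is_trig_mxP Ut /induced_pow_supp[s h]; apply/forallP.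
apply: (@nondecr_dominated d r _ _ s^-1%g); rewrite ?enum_val_nondecr // => u.
rewrite leqNgt; apply: contra (h (s^-1 u)%g); rewrite permKV => lt.
by have := Ut _ _ lt; rewrite mxE => ->.
Qed.

(** On the rows in [D], [rho L] uses only coordinates in [D]; on the columns in [D'], [rho U]
    reaches only [D']. The block therefore factors through the product of the two projections. *)
Lemma rank_down_sets_LU (L U : 'M[C]_d) (D D' : {set 'I_#|S|}) :
  is_trig_mx L -> is_trig_mx U^T -> down_set D -> down_set D' ->
  (\rank (coord_proj C D *m rho (L *m U) *m coord_proj C D') <= #|D :&: D'|)%N.
Proof.
move=> Lt Ut dD dD'.
have EL : coord_proj C D *m rho L = coord_proj C D *m rho L *m coord_proj C D.
  apply/matrixP => i j; rewrite coord_projEr !coord_projE.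
  case: ifPn => // iD; case: ifPn => // jD; apply: contraNeq jD => /(induced_pow_trig Lt).
  exact: dD.
have EU : rho U *m coord_proj C D' = coord_proj C D' *m (rho U *m coord_proj C D').
  apply/matrixP => i j; rewrite coord_projE !coord_projEr.
  case: ifPn => // jD; case: ifPn => // iD; apply: contraNeq iD => /(induced_pow_trig_tr Ut).
  exact: dD'.
rewrite induced_powM; move: (rho L) (rho U) EL EU => l u EL EU.
rewrite mulmxA EL -mulmxA EU !mulmxA -(mulmxA _ (coord_proj C D)) coord_projM.
rewrite -!mulmxA; do 2!apply: leq_trans (mxrankM_maxr _ _) _.
by apply: leq_trans (mxrankM_maxl _ _) (rank_coord_proj _ _).
Qed.

(* A nonzero minor at [A] stays nonzero at [A + e], where for generic [e] an LU
   decomposition is available. *)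
Lemma rank_down_sets (A : 'M[C]_d) (D D' : {set 'I_#|S|}) :
  down_set D -> down_set D' ->
  (\rank (coord_proj C D *m rho A *m coord_proj C D') <= #|D :&: D'|)%N.
Proof.
move=> dD dD'; pose M e := coord_proj C D *m rho (A + e%:M) *m coord_proj C D'.
have -> : coord_proj C D *m rho A *m coord_proj C D' = M 0 by rewrite /M raddf0 addr0.
move: (\rank (M 0)) (nonzero_minor (M 0)) => k [f [g fg]].
have [P hP] := tensor_pow_shift r A.
pose Q := map_mx polyC (coord_proj C D *m W^t*) *m P *m map_mx polyC (W *m coord_proj C D').
have MQ e : M e = map_mx (horner_eval e) Q.
  have cK m n (N : 'M[C]_(m, n)) : map_mx (horner_eval e) (map_mx polyC N) = N.
    by apply/matrixP => i j; rewrite !mxE /= /horner_eval hornerC.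
  by rewrite /Q !map_mxM hP !cK /M /rho !mulmxA.
have detQ e : \det (mxsub f g (M e)) = (\det (mxsub f g Q)).[e].
  by rewrite MQ -map_mxsub det_map_mx.
have q0 : \det (mxsub f g Q) != 0.
  by apply: contraNneq fg => q0; rewrite detQ q0 horner0.
have [e [qe [L [U [LU Lt Ut]]]]] := generic_shift_LU A q0.
apply: leq_trans (mxrank_minor (f := f) (g := g) (M := M e) _) _; first by rewrite detQ.
by rewrite /M LU; apply: rank_down_sets_LU.
Qed.

(** Taking [rho V *m X] as the frame leaves the single unitary [U *m V^t*] to which the rank bound
    applies. *)
Lemma sqnorm_down_sets (U V : 'M[C]_d) k (X : 'M[C]_(#|S|, k)) (D D' : {set 'I_#|S|}) :
  U \is unitarymx -> V \is unitarymx -> X^t* *m X = 1%:M -> down_set D -> down_set D' ->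
  sqnorm (coord_proj C D *m (rho U *m X)) + sqnorm (coord_proj C D' *m (rho V *m X)) <=
  k%:R + #|D :&: D'|%:R.
Proof.
move=> Uu Vu XX dD dD'.
have VCu : V^t* \is unitarymx by rewrite trmxC_unitary.
have UVu := mul_unitarymx Uu VCu.
have VX : (rho V *m X)^t* *m (rho V *m X) = 1%:M.
  by rewrite trmxCM -mulmxA (mulmxA ((rho V)^t*)) induced_pow_unitary ?mul1mx.
have -> : rho U *m X = rho (U *m V^t*) *m (rho V *m X).
  rewrite mulmxA -induced_powM -mulmxA -(invmx_unitary Vu).
  by rewrite (mulVmx (unitarymx_unit Vu)) mulmx1.
apply: le_trans (sqnorm_two_coord_projs _ _ _ VX) _.
  exact: induced_pow_unitary UVu.
by rewrite lerD2l ler_nat rank_down_sets.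
Qed.

Definition tuple_prod (a : 'rV[R]_d) : 'rV[R]_#|S| :=
  \row_(j < #|S|) \prod_(t < r) a 0 (enum_val j t).

Lemma tuple_prod_ge0 (a : 'rV[R]_d) j : (forall i, 0 <= a 0 i) -> 0 <= tuple_prod a 0 j.
Proof. by move=> a0; rewrite mxE prodr_ge0. Qed.

Lemma tuple_prod_anti (a : 'rV[R]_d) i j :
  (forall i, 0 <= a 0 i) -> (forall i j : 'I_d, (i <= j)%N -> a 0 j <= a 0 i) ->
  tuple_le i j -> tuple_prod a 0 j <= tuple_prod a 0 i.
Proof.
move=> a0 anti /forallP ij; rewrite !mxE; apply: ler_prod => t _.
by rewrite a0 anti.
Qed.

Lemma prod_sumsE (a b : 'rV[R]_d) j :
  prod_sums S a b 0 j = tuple_prod a 0 j + tuple_prod b 0 j.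
Proof. by rewrite !mxE. Qed.

Lemma induced_pow_factor (A U V : 'M[C]_d) (a : 'rV[R]_d) :
  A = U^t* *m diag_mx (cmx a) *m V ->
  rho A = (rho U)^t* *m diag_mx (cmx (tuple_prod a)) *m rho V.
Proof.
move=> ->; rewrite !induced_powM induced_powC induced_pow_diag.
suff -> : cmx (tuple_prod a) = \row_(j < #|S|) \prod_(t < r) cmx a 0 (enum_val j t) by [].
apply/rowP => j; rewrite !mxE rmorph_prod.
by apply: eq_bigr => t _; rewrite mxE.
Qed.

(** [coupled_levels_le] is applied with [F] the [k] best tuples and the [k]-th largest entry of
    [prod_sums] as threshold; monotonicity of the products makes the level sets down-sets. *)
Lemma down_set_weights_le (a b : 'rV[R]_d) k (p q : 'I_#|S| -> R) :
  (1 <= k <= #|S|)%N ->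
  (forall i, 0 <= a 0 i) -> (forall i j : 'I_d, (i <= j)%N -> a 0 j <= a 0 i) ->
  (forall i, 0 <= b 0 i) -> (forall i j : 'I_d, (i <= j)%N -> b 0 j <= b 0 i) ->
  (forall i, p i <= 1) -> (forall i, q i <= 1) ->
  (forall D D', down_set D -> down_set D' ->
     \sum_(i in D) p i + \sum_(i in D') q i <= k%:R + #|D :&: D'|%:R) ->
  \sum_i tuple_prod a 0 i * p i + \sum_i tuple_prod b 0 i * q i <=
  \sum_(i < #|S| | (i < k)%N) decr (prod_sums S a b) 0 i.
Proof.
move=> kS a0 aanti b0 banti p1 q1 key.
have [F [j [Fk -> Fin Fout]]] := top_set (prod_sums S a b) kS.
rewrite (eq_bigr _ (fun i _ => prod_sumsE a b i)).
apply: (@coupled_levels_le _ _ _ _ _ _ F (prod_sums S a b 0 j)) => //.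
- by rewrite prod_sumsE addr_ge0 ?tuple_prod_ge0.
- by move=> i; rewrite tuple_prod_ge0.
- by move=> i; rewrite tuple_prod_ge0.
- by move=> i /Fin; rewrite [leRHS]prod_sumsE.
- by move=> i /Fout; rewrite [leLHS]prod_sumsE.
move=> s; set t := prod_sums S a b 0 j.
pose D := [set i | s < tuple_prod a 0 i]; pose D' := [set i | t - s <= tuple_prod b 0 i].
have dD : down_set D.
  by move=> i l; rewrite !inE => lt il; apply: lt_le_trans lt _; apply: tuple_prod_anti.
have dD' : down_set D'.
  by move=> i l; rewrite !inE => le il; apply: le_trans le _; apply: tuple_prod_anti.
have -> : \sum_(i | s < tuple_prod a 0 i) p i = \sum_(i in D) p i.
  by apply: eq_bigl => i; rewrite inE.
have -> : \sum_(i | t - s <= tuple_prod b 0 i) q i = \sum_(i in D') q i.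
  by apply: eq_bigl => i; rewrite inE.
apply: le_trans (key D D' dD dD') _; rewrite Fk lerD2l ler_nat.
by apply: subset_leq_card; apply/subsetP => i; rewrite !inE.
Qed.

Lemma frame_weights_le (U V : 'M[C]_d) (a b : 'rV[R]_d) k (X : 'M[C]_(#|S|, k)) :
  U \is unitarymx -> V \is unitarymx -> X^t* *m X = 1%:M -> (1 <= k <= #|S|)%N ->
  (forall i, 0 <= a 0 i) -> (forall i j : 'I_d, (i <= j)%N -> a 0 j <= a 0 i) ->
  (forall i, 0 <= b 0 i) -> (forall i j : 'I_d, (i <= j)%N -> b 0 j <= b 0 i) ->
  \sum_i tuple_prod a 0 i * row_sqnorm (rho U *m X) i +
  \sum_i tuple_prod b 0 i * row_sqnorm (rho V *m X) i <=
  \sum_(i < #|S| | (i < k)%N) decr (prod_sums S a b) 0 i.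
Proof.
move=> Uu Vu XX kS a0 aanti b0 banti.
have frame (Z : 'M[C]_d) : Z \is unitarymx -> (rho Z *m X)^t* *m (rho Z *m X) = 1%:M.
  move=> Zu; rewrite trmxCM -mulmxA (mulmxA ((rho Z)^t*)) induced_pow_unitary //.
  by rewrite mul1mx.
apply: (@down_set_weights_le a b k (row_sqnorm (rho U *m X)) (row_sqnorm (rho V *m X)) kS
  a0 aanti b0 banti).
- by move=> i; exact: row_sqnorm_le1 (frame U Uu).
- by move=> i; exact: row_sqnorm_le1 (frame V Vu).
by move=> D D' dD dD'; exact: sum_row_sqnorm_le (sqnorm_down_sets Uu Vu XX dD dD').
Qed.

(* The arithmetic-geometric mean inequality separates the two frames [X] and [Y],
   each of which is handled by [frame_weights_le]. *)
Lemma re_trace_frames_le (A B UA VA UB VB : 'M[C]_d) (a b : 'rV[R]_d) k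
    (X Y : 'M[C]_(#|S|, k)) :
  UA \is unitarymx -> VA \is unitarymx -> UB \is unitarymx -> VB \is unitarymx ->
  A = UA^t* *m diag_mx (cmx a) *m VA -> B = UB^t* *m diag_mx (cmx b) *m VB ->
  X^t* *m X = 1%:M -> Y^t* *m Y = 1%:M -> (1 <= k <= #|S|)%N ->
  (forall i, 0 <= a 0 i) -> (forall i j : 'I_d, (i <= j)%N -> a 0 j <= a 0 i) ->
  (forall i, 0 <= b 0 i) -> (forall i j : 'I_d, (i <= j)%N -> b 0 j <= b 0 i) ->
  complex.Re (\tr (Y^t* *m (rho A + rho B) *m X)) <=
  \sum_(i < #|S| | (i < k)%N) decr (prod_sums S a b) 0 i.
Proof.
move=> UAu VAu UBu VBu AE BE XX YY kS a0 aanti b0 banti.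
rewrite (induced_pow_factor AE) (induced_pow_factor BE) re_trace_add.
have tA i := tuple_prod_ge0 i a0; have tB i := tuple_prod_ge0 i b0.
apply: le_trans (lerD (re_trace_conj_le (rho UA) (rho VA) Y X tA)
                      (re_trace_conj_le (rho UB) (rho VB) Y X tB)) _.
by apply: half_sums_le; apply: frame_weights_le.
Qed.

Lemma induced_pow_weak_maj (A B : 'M[C]_d) :
  weak_maj (sigma_vec (rho A + rho B)) (decr (prod_sums S (sigma_vec A) (sigma_vec B))).
Proof.
move=> k kS; rewrite decr_sigma_vec (decrK (prod_sums _ _ _)).
have [UA [VA [UAu VAu AE]]] := singular_value_decomposition A.
have [UB [VB [UBu VBu BE]]] := singular_value_decomposition B.
have [U [V [Uu Vu ME]]] := singular_value_decomposition (rho A + rho B).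
have [X [Y [XX YY <-]]] := top_frames Uu Vu kS ME.
apply: (re_trace_frames_le UAu VAu UBu VBu AE BE XX YY kS).
- exact: sigma_vec_ge0.
- exact: sigma_vec_anti.
- exact: sigma_vec_ge0.
- exact: sigma_vec_anti.
Qed.

Lemma induced_pow_hermitian (A : 'M[C]_d) : A \is hermsymmx -> rho A \is hermsymmx.
Proof.
by move=> /hermsymmxE AE; apply/hermsymmxE; rewrite -induced_powC AE.
Qed.

(** For [A] and [B] positive semidefinite, a spectral decomposition is a singular value
    decomposition with equal unitary factors, so the previous bound applies; the totals agree by
    comparing traces. *)
Lemma induced_pow_maj (A B : 'M[C]_d) : psd A -> psd B ->
  maj (lambda_vec (rho A + rho B)) (decr (prod_sums S (lambda_vec A) (lambda_vec B))).
Proof.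
move=> Ap Bp.
have Mh : rho A + rho B \is hermsymmx :=
  hermsymmxD (induced_pow_hermitian Ap.1) (induced_pow_hermitian Bp.1).
have [UA UAu AE] := hermitian_spectral Ap.1.
have [UB UBu BE] := hermitian_spectral Bp.1.
have [U Uu ME] := hermitian_spectral Mh.
split.
  move=> k kS; rewrite decr_lambda_vec (decrK (prod_sums _ _ _)).
  have [X [Y [XX YY <-]]] := top_frames Uu Uu kS ME.
  apply: (re_trace_frames_le UAu UAu UBu UBu AE BE XX YY kS).
  - by move=> i; apply: lambda_vec_ge0.
  - exact: lambda_vec_anti.
  - by move=> i; apply: lambda_vec_ge0.
  - exact: lambda_vec_anti.
have tr_conj n (V : 'M[C]_n) (c : 'rV[R]_n) : V^t* *m V = 1%:M ->
    \tr (V^t* *m diag_mx (cmx c) *m V) = (\sum_i c 0 i)%:C%C.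
  move=> VV; rewrite -mulmxA mxtrace_mulC -mulmxA (mulmx1C VV) mulmx1 mxtrace_diag rmorph_sum.
  by apply: eq_bigr => i _; rewrite mxE.
have UU : U^t* *m U = 1%:M by apply: mulmx1C; apply/unitarymxP.
have trM := congr1 mxtrace ME; rewrite (tr_conj _ _ _ UU) mxtraceD in trM.
rewrite (decrK (prod_sums _ _ _)) decr_lambda_vec (sum_decr (prod_sums _ _ _)).
apply: (@complexI R).
rewrite -trM (induced_pow_factor AE) (induced_pow_factor BE).
rewrite !tr_conj; try exact: induced_pow_unitary.
rewrite -rmorphD -big_split; congr (_%:C%C); apply: eq_bigr => i _.
by rewrite prod_sumsE.
Qed.

End InducedPow.

(** * The wedge and symmetric bases *)

Lemma wedge_basis_supp (R : realType) (d r : nat) i j :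
  wedge_basis R d r i j != 0 -> exists s, enum_val i = multi_perm (enum_val j) s.
Proof.
move=> nz; have /existsP[s /eqP e] : [exists s : 'S_r, enum_val i == multi_perm (enum_val j) s].
  apply: contraT; rewrite negb_exists => /forallP no; case/eqP: nz.
  rewrite !mxE summxE big1 ?mulr0 // => s _; rewrite !mxE [i == _](_ : _ = false) ?mulr0 //.
  by apply: contraNF (no s) => /eqP ->; rewrite enum_rankK.
by exists s.
Qed.

Lemma sym_basis_supp (R : realType) (d r : nat) i j :
  sym_basis R d r i j != 0 -> exists s, enum_val i = multi_perm (enum_val j) s.
Proof.
move=> nz; have /existsP[s /eqP e] : [exists s : 'S_r, enum_val i == multi_perm (enum_val j) s].
  apply: contraT; rewrite negb_exists => /forallP no; case/eqP: nz.
  rewrite !mxE summxE big1 ?mulr0 // => s _; rewrite !mxE [i == _](_ : _ = false) //.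
  by apply: contraNF (no s) => /eqP ->; rewrite enum_rankK.
by exists s.
Qed.

Lemma incr_sub_nondecr (d r : nat) : incr_tuples d r \subset nondecr_tuples d r.
Proof. by apply/subsetP => g; rewrite incr_nondecr => /andP[]. Qed.

Theorem corollary3 (R : realType) (d : nat) (A B : 'M[R[i]]_d) :
  (forall r : nat, (1 <= r <= d)%N ->
     weak_maj (sigma_vec (ext_pow r A + ext_pow r B))
              (decr (prod_sums (incr_tuples d r) (sigma_vec A) (sigma_vec B))))
  /\
  (forall r : nat, (1 <= r)%N ->
     weak_maj (sigma_vec (sym_pow r A + sym_pow r B))
              (decr (prod_sums (nondecr_tuples d r) (sigma_vec A) (sigma_vec B))))
  /\
  (psd A -> psd B ->
     (forall r : nat, (1 <= r <= d)%N ->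
        maj (lambda_vec (ext_pow r A + ext_pow r B))
            (decr (prod_sums (incr_tuples d r) (lambda_vec A) (lambda_vec B))))
     /\
     (forall r : nat, (1 <= r)%N ->
        maj (lambda_vec (sym_pow r A + sym_pow r B))
            (decr (prod_sums (nondecr_tuples d r) (lambda_vec A) (lambda_vec B))))).
Proof.
split; last split; last first.
- move=> Ap Bp; split=> r _.
    exact: (induced_pow_maj (incr_sub_nondecr d r) (wedge_basis_orthonormal R d r)
      (@ext_powP R d r) (@wedge_basis_supp R d r) Ap Bp).
  exact: (induced_pow_maj (subxx _) (sym_basis_orthonormal R d r)
      (@sym_powP R d r) (@sym_basis_supp R d r) Ap Bp).
- move=> r _; exact: (induced_pow_weak_maj (subxx _) (sym_basis_orthonormal R d r)
      (@sym_powP R d r) (@sym_basis_supp R d r) A B).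
move=> r _; exact: (induced_pow_weak_maj (incr_sub_nondecr d r) (wedge_basis_orthonormal R d r)
      (@ext_powP R d r) (@wedge_basis_supp R d r) A B).
Qed.
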